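(* Let $Y,Z$ be rearrangement invariant Banach function spaces and $X=Y^{1/2}Z^{1/2}$. Assume that $B$ is a rearrangement invariant Banach function space such that, for some constant $C>0$, $$\|\nabla u\|_{B}\leq C\,\|\nabla^2 u\|_Y^{\frac{1}{2}}\|u\|_Z^{\frac{1}{2}}$$ holds for all $u\in W^{2,1}_{\mathrm{loc}}(\mathbb{R}^d)\cap Z$. (i) If $Z\cap L^{\infty}\subset Y\cap L^{\infty}$, then $X\cap L^{\infty}\subset B\cap L^{\infty}$. (ii) If $Z\cap L^{1}\subset Y\cap L^{1}$, then $X\cap L^{1}\subset B\cap L^{1}$.
   Context: A Banach function space (B.f. space) over $(0,\infty)$ with Lebesgue measure is a Banach space $X$ of a.e. finite measurable functions with the ideal property ($|f|\le g$, $g\in X$ implies $f\in X$, $\|f\|_X\le\|g\|_X$) and the Fatou property ($0\le f_n\uparrow f$ a.e., $\sup_n\|f_n\|_X<\infty$ implies $f\in X$, $\|f\|_X=\sup_n\|f_n\|_X$). It is rearrangement invariant if equimeasurable functions have equal norms. All spaces are considered over $(0,\infty)$; for a measurable $f$ on $\mathbb{R}^d$, $f^*$ denotes its nonincreasing rearrangement, $\|f\|_X:=\|f^*\|_X$ and $f\in X$ means $f^*\in X$. Derivatives are distributional, $|\nabla^k u|:=\sum_{|\alpha|=k}|\partial^\alpha u|$, $\|\nabla^k u\|_X:=\||\nabla^k u|\|_X$. The Calderón–Lozanovskii space $Y^{1/2}Z^{1/2}$ consists of all $f$ with $|f|\le g^{1/2}h^{1/2}$ for some $0\le g\in Y$,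 $0\le h\in Z$, normed by $\inf\max\{\|g\|_Y,\|h\|_Z\}$ over such representations. *)

(* Defs.v *)
From HB Require Import structures.
From mathcomp Require Import all_boot all_order all_algebra.
From mathcomp Require Import all_classical all_reals all_analysis.
Set Implicit Arguments.
Unset Strict Implicit.
Unset Printing Implicit Defensive.
Import Order.TTheory GRing.Theory Num.Theory.
Import numFieldNormedType.Exports.
Local Open Scope classical_set_scope.
Local Open Scope ring_scope.

(* A "function norm" rho is defined on all real functions on R; only the     *)
(* values on (0,oo) matter (this follows from the ideal property below).     *)

Section halfline.
Variable R : realType.

Definition Ipos : set R := `]0, +oo[%classic.

Definition lebR := (@lebesgue_measure R).

Definition mfun0 (f : R -> R) : Prop := measurable_fun Ipos f.

Definition memX (rho : (R -> R) -> \bar R) (f : R -> R) : Prop :=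
  mfun0 f /\ (rho f < +oo)%E.

Record BFS (rho : (R -> R) -> \bar R) : Prop := {
  bfs_ge0 : forall f, (0 <= rho f)%E ;
  bfs_eq0 : forall f, mfun0 f ->
     (rho f = 0%E <-> {ae lebR, forall x, Ipos x -> f x = 0}) ;
  bfs_scale : forall (k : R) f, mfun0 f ->
     rho (fun x => k * f x) = (`|k|%:E * rho f)%E ;
  bfs_triangle : forall f g, mfun0 f -> mfun0 g ->
     (rho (fun x => (f x + g x)%R) <= rho f + rho g)%E ;
  bfs_ideal : forall f g, mfun0 f -> mfun0 g ->
     {ae lebR, forall x, Ipos x -> `|f x| <= `|g x|} -> (rho f <= rho g)%E ;
  bfs_fatou : forall (fn : nat -> R -> R) (f : R -> R),
     (forall n, mfun0 (fn n)) -> mfun0 f ->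
     {ae lebR, forall x, Ipos x ->
        (forall n, 0 <= fn n x <= fn n.+1 x) /\ (fn n x @[n --> \oo] --> f x)} ->
     (ereal_sup (range (fun n => rho (fn n))) < +oo)%E ->
     rho f = ereal_sup (range (fun n => rho (fn n))) ;
  bfs_complete : forall (fn : nat -> R -> R),
     (forall n, memX rho (fn n)) ->
     (forall e : R, 0 < e -> exists N : nat, forall m n : nat, (N <= m)%N -> (N <= n)%N ->
        (rho (fun x => (fn n x - fn m x)%R) < e%:E)%E) ->
     exists f, memX rho f /\
       (forall e : R, 0 < e -> exists N : nat, forall n : nat, (N <= n)%N ->
          (rho (fun x => (fn n x - f x)%R) < e%:E)%E)
}.

Definition RIBFS (rho : (R -> R) -> \bar R) : Prop :=
  BFS rho /\
  forall f g, mfun0 f -> mfun0 g ->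
    (forall s : R, 0 <= s ->
       lebR [set x | Ipos x /\ s < `|f x|] = lebR [set x | Ipos x /\ s < `|g x|]) ->
    rho f = rho g.

Definition memCL (rhoY rhoZ : (R -> R) -> \bar R) (f : R -> R) : Prop :=
  mfun0 f /\
  exists g h : R -> R, memX rhoY g /\ memX rhoZ h /\
    {ae lebR, forall x, Ipos x -> 0 <= g x /\ 0 <= h x} /\
    {ae lebR, forall x, Ipos x -> `|f x| <= Num.sqrt (g x) * Num.sqrt (h x)}.

Definition Linf (f : R -> R) : Prop :=
  mfun0 f /\ exists M : R, {ae lebR, forall x, Ipos x -> `|f x| <= M}.

Definition L1 (f : R -> R) : Prop :=
  lebR.-integrable Ipos (EFin \o f).

End halfline.

Section Rd.
Variables (R : realType) (d : nat).

Local Notation Rd := 'rV[R]_d.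

Definition box (a b : Rd) : set Rd :=
  [set x | forall i, a ord0 i < x ord0 i <= b ord0 i].

Definition boxvol (a b : Rd) : R := \prod_(i < d) Num.max (b ord0 i - a ord0 i) 0.

Definition lebo (A : set Rd) : \bar R :=
  ereal_inf [set (\sum_(k <oo) (boxvol (ab.1 k) (ab.2 k))%:E)%E
            | ab in [set ab : (nat -> Rd) * (nat -> Rd)
                      | A `<=` \bigcup_k box (ab.1 k) (ab.2 k)]].

Definition lmeasurable (A : set Rd) : Prop :=
  forall E, lebo E = (lebo (E `&` A) + lebo (E `&` ~` A))%E.

Definition lmeasurable_fun (u : Rd -> R) : Prop :=
  forall a : R, lmeasurable [set x | a < u x].

(* integral of a nonnegative measurable function (layer-cake definition) *)
Definition intd (f : Rd -> R) : \bar R :=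
  (\int[@lebR R]_(t in @Ipos R) lebo [set x | (t : R) < f x]%R)%E.

Definition rintd (f : Rd -> R) : R :=
  fine (intd (fun x => Num.max (f x) 0)) - fine (intd (fun x => Num.max (- f x) 0)).

Definition locint (u : Rd -> R) : Prop :=
  lmeasurable_fun u /\
  forall r : R, 0 < r -> (intd (fun x => if (`|x| <= r)%R then `|u x|%R else 0%R) < +oo)%E.

Definition ee (i : 'I_d) : Rd := delta_mx ord0 i.

Definition iterpd (s : seq 'I_d) (f : Rd -> R) : Rd -> R :=
  foldr (fun i g => 'D_(ee i) g) f s.

Definition smooth (f : Rd -> R) : Prop :=
  forall s : seq 'I_d, continuous (iterpd s f) /\
    forall (i : 'I_d) (x : Rd), derivable (iterpd s f) x (ee i).

Definition testfun (phi : Rd -> R) : Prop :=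
  smooth phi /\ exists r : R, forall x, r < `|x| -> phi x = 0.

(* g is the weak derivative D^alpha u, alpha given by the list of
   coordinate directions s (|alpha| = size s) *)
Definition weakD (u : Rd -> R) (s : seq 'I_d) (g : Rd -> R) : Prop :=
  forall phi, testfun phi ->
    rintd (fun x => u x * iterpd s phi x) = (-1) ^+ size s * rintd (fun x => g x * phi x).

Definition W21loc (u : Rd -> R) (Du : 'I_d -> Rd -> R) (D2u : 'I_d -> 'I_d -> Rd -> R) : Prop :=
  locint u /\
  (forall i, locint (Du i) /\ weakD u [:: i] (Du i)) /\
  (forall i j, locint (D2u i j) /\ weakD u [:: i; j] (D2u i j)).

Definition ustar (u : Rd -> R) (t : R) : \bar R :=
  ereal_inf [set s%:E | s in [set s : R | 0 <= s /\ (lebo [set x | (s < `|u x|)%R] <= t%:E)%E]].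

Definition nrmd (rho : (R -> R) -> \bar R) (u : Rd -> R) : \bar R :=
  if `[< forall t, 0 < t -> (ustar u t < +oo)%E >]
  then rho (fun t => fine (ustar u t)) else +oo%E.

Definition memd (rho : (R -> R) -> \bar R) (u : Rd -> R) : Prop :=
  (forall t, 0 < t -> (ustar u t < +oo)%E) /\ memX rho (fun t => fine (ustar u t)).

Definition gradn (Du : 'I_d -> Rd -> R) (x : Rd) : R := \sum_(i < d) `|Du i x|.

(* sum over multi-indices of length 2: pairs i <= j *)
Definition hessn (D2u : 'I_d -> 'I_d -> Rd -> R) (x : Rd) : R :=
  \sum_(i < d) \sum_(j < d | (i <= j)%N) `|D2u i j x|.

End Rd.

(* Main.v *)
(* After the usual density argument it suffices to bound B-norms of step
   functions. Let g = sum a_k 1_(E_k) and h = sum b_k 1_(E_k) be step functions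
   on (0,oo) with a_k, b_k > 0. Take s_k = e sqrt(b_k / a_k) with e small, fill
   the measure of E_k, up to a factor 2, with disjoint cubes of side s_k, and
   put on each of them a C^2 bump of height b_k. The resulting u has |u| ~ b_k,
   |grad u| ~ sqrt(a_k b_k) / e and |grad^2 u| ~ a_k / e^2 on the cubes filling
   E_k. Since e cancels in the interpolation inequality, rearrangement
   invariance gives
     |sqrt(g h)|_B <= A |g|_Y^(1/2) |h|_Z^(1/2)
   with A independent of g and h, and the Fatou property extends this to all
   g in Y and h in Z. Hence Y^(1/2) Z^(1/2) is contained in B. *)
From HB Require Import structures.
From mathcomp Require Import all_boot all_order all_algebra.
From mathcomp Require Import all_classical all_reals all_analysis.
From mathcomp Require Import measurable_realfun ring lra.
(* Defs comes last: measurable_realfun exports another [mfun0]. *)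
Require Import Defs.
Import Order.TTheory GRing.Theory Num.Theory.
Import numFieldNormedType.Exports.
Local Open Scope classical_set_scope.
Local Open Scope ring_scope.

(** * Volume of boxes *)

(** Nothing is built inside the sets E_k: the cubes lie along the diagonal of R^d, and only
    distribution functions are compared. For u and its Hessian an upper bound of the distribution is
    wanted, so the cubes standing for E_k may not exceed its measure. For the gradient a lower bound
    is wanted, and it fails near the boundary of a cube and near its centre, where the derivative of
    the bump vanishes. The gradient is therefore controlled only on a fixed fraction of the measure
    of E_k. That loss is repaired by cutting E_k into finitely many pieces of equal measure and
    using the triangle inequality in B, which costs a factor depending on d alone. The smallness of
    e serves two purposes: sides at most 1 keep the cubes apart, and sides at most the measure of
    E_k make it harmless to round the number of cubes down. Measure and integral on R^d are given by
    box covers and by the layer-cake formula. Volumes of disjoint boxes, countable additivity and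
    integration by parts have to be derived from these before the bumps are known to have the
    expected weak derivatives. *)

Section box_volume.
Context {R : realType} {d : nat}.
Local Notation V := 'rV[R]_d.

Lemma boxvol_ge0 (a b : V) : 0 <= boxvol a b.
Proof. by apply: prodr_ge0 => i _; rewrite le_max lexx orbT. Qed.

Let upd (x : V) (j : 'I_d) (t : R) : V :=
  \row_i (if i == j then t else x ord0 i).

(* Indicator of a box with its first [m] coordinates integrated out. *)
Let partial_vol (m : nat) (a b x : V) : R :=
  \prod_(i < d) (if (i < m)%N then Num.max (b ord0 i - a ord0 i) 0
                 else \1_(`]a ord0 i, b ord0 i]%classic) (x ord0 i)).

Let partial_vol_ge0 m a b x : 0 <= partial_vol m a b x.
Proof.
apply: prodr_ge0 => i _; case: ifP => _; last by [].
by rewrite le_max lexx orbT.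
Qed.

Let rest (j : 'I_d) (a b x : V) : R :=
  \prod_(i < d | i != j)
    (if (i < j)%N then Num.max (b ord0 i - a ord0 i) 0
     else \1_(`]a ord0 i, b ord0 i]%classic) (x ord0 i)).

Let rest_ge0 j a b x : 0 <= rest j a b x.
Proof.
apply: prodr_ge0 => i _; case: ifP => _; last by [].
by rewrite le_max lexx orbT.
Qed.

Let partial_vol_upd (j : 'I_d) a b x t :
  partial_vol j a b (upd x j t) =
  rest j a b x * \1_(`]a ord0 j, b ord0 j]%classic) t.
Proof.
rewrite /partial_vol (bigD1 j)//= ltnn mxE eqxx mulrC; congr (_ * _).
by apply: eq_bigr => i ij; rewrite mxE (negbTE ij).
Qed.

Let measurable_partial_vol (j : 'I_d) a b x :
  measurable_fun [set: R] (fun t : R => (partial_vol j a b (upd x j t))%:E).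
Proof.
apply/measurable_EFinP; under eq_fun do rewrite partial_vol_upd.
by apply: measurable_funM => //; exact: measurable_indic.
Qed.

Let integral_partial_vol (j : 'I_d) a b x :
  (\int[@lebesgue_measure R]_t (partial_vol j a b (upd x j t))%:E)%E
  = (partial_vol j.+1 a b x)%:E.
Proof.
under eq_integral do rewrite partial_vol_upd EFinM.
rewrite ge0_integralZl_EFin//; last first.
  by apply/measurable_EFinP; exact: measurable_indic.
rewrite integral_indic//= setIT lebesgue_measure_itv/= lte_fin.
rewrite /partial_vol (bigD1 j)//= ltnSn.
have -> : \prod_(i < d | i != j)
    (if (i < j.+1)%N then Num.max (b ord0 i - a ord0 i) 0
     else \1_(`]a ord0 i, b ord0 i]%classic) (x ord0 i)) = rest j a b x.
  apply: eq_bigr => i ij; rewrite ltnS leq_eqVlt.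
  by rewrite (negbTE (ij : val i != val j)).
rewrite mulrC EFinM; congr (_ * _)%E; case: ltP => ab.
  by rewrite -EFinB max_l// subr_ge0 ltW.
by rewrite max_r// subr_le0.
Qed.

Let indic_box (a b x : V) : \1_(box a b) x = partial_vol 0 a b x.
Proof.
rewrite /partial_vol indicE; have [xab|xab] := boolP (x \in box a b).
  rewrite big1// => i _ /=; rewrite indicE mem_set//=.
  by move: xab; rewrite inE => /(_ i); rewrite in_itv.
have [i xi] : exists i, ~ (a ord0 i < x ord0 i <= b ord0 i).
  by apply/existsNP => h; move/negP: xab; apply; rewrite inE.
by rewrite (bigD1 i)//= indicE memNset ?mul0r//= in_itv.
Qed.

(** The inequality between indicators is integrated in one coordinate at a time. Each integration
    replaces an indicator factor by a side length and, by monotone convergence, commutes with the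
    series. After [d] integrations both sides are volumes; only the measure on the line is used. *)
Lemma boxvol_le_cover (I : Type) (s : seq I) (a b : I -> V) (p q : nat -> V) :
  (forall x, (\sum_(i <- s) (\1_(box (a i) (b i)) x : R)%:E
    <= \sum_(k <oo) (\1_(box (p k) (q k)) x : R)%:E)%E) ->
  ((\sum_(i <- s) boxvol (a i) (b i))%:E
    <= \sum_(k <oo) (boxvol (p k) (q k))%:E)%E.
Proof.
move=> h.
have {h}H m : (m <= d)%N -> forall x : V,
   (\sum_(i <- s) (partial_vol m (a i) (b i) x)%:E
    <= \sum_(k <oo) (partial_vol m (p k) (q k) x)%:E)%E.
  elim: m => [_ x|m IH md x].
    under eq_bigr do rewrite -indic_box.
    by under eq_eseriesr do rewrite -indic_box; exact: h.
  pose j := Ordinal md.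
  under eq_bigr do rewrite -(integral_partial_vol j).
  under eq_eseriesr do rewrite -(integral_partial_vol j).
  rewrite -ge0_integral_sum//; [|by move=> n; exact: measurable_partial_vol
    |by move=> n t _; rewrite lee_fin].
  rewrite -integral_nneseries//; [|by move=> n; exact: measurable_partial_vol
    |by move=> n t _; rewrite lee_fin].
  apply: ge0_le_integral => //.
  - by move=> t _; apply: sume_ge0 => i _; rewrite lee_fin.
  - by apply: emeasurable_sum => i; exact: measurable_partial_vol.
  - apply: ge0_emeasurable_sum => [k t _ _|k _]; first by rewrite lee_fin.
    exact: measurable_partial_vol.
  - by move=> t _; apply: IH; exact: ltnW.
have vE (u v : V) : boxvol u v = partial_vol d u v 0.
  by apply: eq_bigr => i _; rewrite ltn_ord.
rewrite -sumEFin; under eq_bigr do rewrite vE.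
by under eq_eseriesr do rewrite vE; exact: H.
Qed.

End box_volume.

(** * The outer measure defined by box covers *)

Section lebo_outer_measure.
Context {R : realType} {n : nat}.
Local Notation V := 'rV[R]_n.+1.
Implicit Types (A B : set V) (a b : V).
Local Open Scope ereal_scope.

Lemma lebo_cover A (p q : nat -> V) : A `<=` \bigcup_k box (p k) (q k) ->
  lebo A <= \sum_(k <oo) (boxvol (p k) (q k))%:E.
Proof. by move=> Apq; apply: ereal_inf_lbound; exists (p, q). Qed.

Lemma lebo_ge0 A : 0 <= lebo A.
Proof.
apply: le_ereal_inf_tmp => _ [pq _ <-].
by apply: nneseries_ge0 => k _ _; rewrite lee_fin boxvol_ge0.
Qed.

Lemma box0 : box (0 : V) 0 = set0.
Proof.
by apply/seteqP; split => x // /(_ ord0); rewrite mxE => /andP[/lt_le_trans h /h];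
  rewrite ltxx.
Qed.

(** A coordinate is needed here, since an empty product would be 1; hence the dimension [n.+1]. *)
Lemma boxvol0 : boxvol (0 : V) 0 = 0%R.
Proof. by rewrite /boxvol big_ord_recl mxE subrr max_l// mul0r. Qed.

Lemma lebo_box_le a b : lebo (box a b) <= (boxvol a b)%:E.
Proof.
apply: (@le_trans _ _ (\sum_(k <oo) (boxvol (if k is 0%N then a else 0%R)
    (if k is 0%N then b else 0%R))%:E)).
  by apply: lebo_cover => x abx; exists 0%N.
rewrite nneseries_recl//; last by move=> k _; rewrite lee_fin boxvol_ge0.
rewrite [X in _ + X]eseries0 ?adde0// => -[//|k] _ _.
by rewrite boxvol0.
Qed.

Lemma lebo0 : lebo (set0 : set V) = 0.
Proof.
apply/eqP; rewrite eq_le lebo_ge0 andbT.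
by rewrite -[leRHS]/(0%R%:E) -boxvol0 -{1}box0 lebo_box_le.
Qed.

Lemma le_lebo A B : A `<=` B -> lebo A <= lebo B.
Proof.
move=> AB; apply: le_ereal_inf_tmp => _ [pq Bpq <-]; apply: lebo_cover.
exact: subset_trans AB Bpq.
Qed.

Lemma lebo_adherent A (e : R) : lebo A < +oo -> (0 < e)%R ->
  exists pq : (nat -> V) * (nat -> V),
    A `<=` \bigcup_k box (pq.1 k) (pq.2 k) /\
    \sum_(k <oo) (boxvol (pq.1 k) (pq.2 k))%:E <= lebo A + e%:E.
Proof.
move=> Aoo e0.
have Afin : lebo A \is a fin_num by rewrite ge0_fin_numE ?lebo_ge0.
have [_ [pq Apq <-] h] := lb_ereal_inf_adherent e0 Afin.
by exists pq; split => //; exact: ltW.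
Qed.

Lemma lebo_sigma_subadditive : sigma_subadditive (@lebo R n.+1).
Proof.
move=> A; have [[i ioo]|] := pselect (exists i, lebo (A i) = +oo).
  rewrite (eseries_pinfty _ _ ioo) ?leey// => k _.
  by rewrite -ltNye (lt_le_trans _ (lebo_ge0 _)).
rewrite -forallNE => Aoo.
apply/lee_addgt0Pr => e e0.
rewrite (le_trans _ (epsilon_trick _ _ (ltW e0)))//; last first.
  by move=> k; exact: lebo_ge0.
have /choice[pq pqP] : forall k, exists pq : (nat -> V) * (nat -> V),
    A k `<=` \bigcup_l box (pq.1 l) (pq.2 l) /\
    \sum_(l <oo) (boxvol (pq.1 l) (pq.2 l))%:E
      <= lebo (A k) + (e / (2 ^ k.+1)%:R)%:E.
  move=> k; apply: lebo_adherent; last by rewrite divr_gt0// ltr0n expn_gt0.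
  by rewrite ltey; apply/eqP; exact: Aoo.
pose v (kl : nat * nat) : \bar R :=
  (boxvol ((pq kl.1).1 kl.2) ((pq kl.1).2 kl.2))%:E.
have v0 kl : 0 <= v kl by rewrite lee_fin boxvol_ge0.
(* A bijection of [nat] with [nat * nat] lists the boxes of all the covers in one sequence. *)
have /card_esym/ppcard_eqP[f] := card_nat2.
apply: (@le_trans _ _ (\sum_(k <oo) v (f k))).
  apply: (@lebo_cover _ (fun k => (pq (f k).1).1 (f k).2)
      (fun k => (pq (f k).1).2 (f k).2)) => x [k _ Akx].
  have [l _ xl] := (pqP k).1 _ Akx.
  by exists (f^-1%FUN (k, l)) => //=; rewrite invK ?inE.
rewrite nneseries_esumT; last by move=> k; exact: v0.
rewrite -(reindex_esum setT setT f)//.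
rewrite [leLHS](_ : _ = \sum_(k <oo) \sum_(l <oo) v (k, l)); last first.
  rewrite nneseries_esumT; last first.
    by move=> k; apply: nneseries_ge0 => l _ _; exact: v0.
  rewrite (eq_esum (b := fun k => \esum_(l in [set: nat]) v (k, l))); last first.
    by move=> k _; rewrite nneseries_esumT// => l; exact: v0.
  rewrite esum_esum//; congr (esum _ _).
    by apply/seteqP; split => // -[].
apply: lee_nneseries => // [k _ _|k _].
  by apply: nneseries_ge0 => l _ _; exact: v0.
exact: (pqP k).2.
Qed.

HB.instance Definition _ := isOuterMeasure.Build R V (@lebo R n.+1)
  lebo0 lebo_ge0 le_lebo lebo_sigma_subadditive.

Lemma lebo_bigsetU_box_le (I : Type) (s : seq I) (P : pred I) (a b : I -> V) :
  lebo (\big[setU/set0]_(i <- s | P i) box (a i) (b i)) <=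
  (\sum_(i <- s | P i) boxvol (a i) (b i))%:E.
Proof.
rewrite -sumEFin; elim/big_rec2 : _ => [|i A r Pi h]; first by rewrite lebo0.
by apply: le_trans (outer_measureU2 _ _ _) _; rewrite leeD// lebo_box_le.
Qed.

(** By disjointness the indicators of the boxes add up to at most 1 at each point, and where they
    add up to 1 any cover of [A] contributes at least 1. So [boxvol_le_cover] bounds every cover
    from below. *)
Lemma lebo_ge_disjoint_boxes (I : eqType) (s : seq I) (a b : I -> V) A :
  uniq s ->
  (forall i x, i \in s -> box (a i) (b i) x -> A x) ->
  (forall i j x, i \in s -> j \in s ->
     box (a i) (b i) x -> box (a j) (b j) x -> i = j) ->
  (\sum_(i <- s) boxvol (a i) (b i))%:E <= lebo A.
Proof.
move=> us sA sdisj; apply: le_ereal_inf_tmp => _ [pq Apq <-].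
apply: boxvol_le_cover => x.
have ind0 (B : set V) : 0 <= (\1_B x : R)%:E by rewrite lee_fin.
have [[i [si xi]]|h] := pselect (exists i, i \in s /\ box (a i) (b i) x).
  rewrite (bigD1_seq i)//= big1_seq ?adde0; last first.
    move=> j /andP[ji sj]; rewrite indicE memNset// => xj.
    by move/eqP: ji; apply; exact: sdisj xj xi.
  have [k _ xk] := Apq _ (sA _ _ si xi).
  rewrite (@nneseriesD1 _ _ k)//.
  rewrite indicE mem_set// indicE mem_set// leeDl//.
  exact: nneseries_ge0.
rewrite big1_seq ?nneseries_ge0// => i /= si; rewrite indicE memNset// => xi.
by apply: h; exists i.
Qed.

End lebo_outer_measure.

(** * Lebesgue measure on R^d *)

Section lebo_measurable.
Context {R : realType} {n : nat}.
Local Notation V := 'rV[R]_n.+1.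

Definition lebo_om : {outer_measure set V -> \bar R} := @lebo R n.+1.

(** The measurable sets of this type are by definition those of [lmeasurable], so that general
    measure theory applies to the given notions. *)
Definition leboT := caratheodory_type lebo_om.

Definition lebm : set leboT -> \bar R := @lebo R n.+1.

HB.instance Definition _ := isMeasure.Build _ leboT R lebm
  (@caratheodory_measure0 R V lebo_om) (@caratheodory_measure_ge0 R V lebo_om)
  (@caratheodory_measure_sigma_additive R V lebo_om).

Let cut (x : V) (j : 'I_n.+1) (t : R) : V :=
  \row_i (if i == j then t else x ord0 i).

Let boxvol_cut (j : 'I_n.+1) (c : R) (p q : V) :
  boxvol p (cut q j (Num.min (q ord0 j) c)) +
  boxvol (cut p j (Num.max (p ord0 j) c)) q = boxvol p q.
Proof.
rewrite /boxvol (bigD1 j)//= [X in _ + X](bigD1 j)//= [RHS](bigD1 j)//=.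
rewrite !mxE eqxx.
set P := \prod_(_ < _ | _) _; set P' := \prod_(_ < _ | _) _.
have -> : P = \prod_(i < n.+1 | i != j) Num.max (q ord0 i - p ord0 i) 0.
  by apply: eq_bigr => i ij; rewrite mxE (negbTE ij).
have -> : P' = \prod_(i < n.+1 | i != j) Num.max (q ord0 i - p ord0 i) 0.
  by apply: eq_bigr => i ij; rewrite mxE (negbTE ij).
rewrite -mulrDl; congr (_ * _).
by case: (leP (q ord0 j) c) => ?; case: (leP (p ord0 j) c) => ?;
  do ?[case: leP => ?]; lra.
Qed.

(** Cutting every box of a cover along [x_j = c] gives covers of both parts of [X], and by
    [boxvol_cut] the volumes of the two halves add up. *)
Lemma lmeasurable_halfspace (j : 'I_n.+1) (c : R) :
  measurable ([set x : V | x ord0 j <= c] : set leboT).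
Proof.
set A : set V := [set x : V | x ord0 j <= c].
apply: le_caratheodory_measurable => X.
change (lebo (X `&` A) + lebo (X `&` ~` A) <= lebo X)%E.
have [->|Xoo] := eqVneq (lebo X) +oo%E; first exact: leey.
apply/lee_addgt0Pr => e e0.
have Xy : (lebo X < +oo)%E by rewrite ltey.
have [[p q] /= [Xpq pqe]] := lebo_adherent _ _ Xy e0.
apply: le_trans pqe.
apply: (@le_trans _ _
   (\sum_(k <oo) (boxvol (p k) (cut (q k) j (Num.min (q k ord0 j) c)))%:E +
    \sum_(k <oo) (boxvol (cut (p k) j (Num.max (p k ord0 j) c)) (q k))%:E)%E).
  apply: leeD; apply: lebo_cover.
    move=> x [/Xpq[k _ xk] xc]; exists k => // i; have /andP[px xq] := xk i.
    by rewrite mxE; case: eqP px xq => [->|_] px xq; rewrite ?le_min px xq.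
  move=> x [/Xpq[k _ xk] /negP]; rewrite -ltNge => xc.
  exists k => // i; have /andP[px xq] := xk i.
  by rewrite mxE; case: eqP px xq => [->|_] px xq; rewrite ?gt_max px xq ?xc.
rewrite -nneseriesD; do ?by move=> *; rewrite lee_fin boxvol_ge0.
by under eq_eseriesr do rewrite -EFinD boxvol_cut.
Qed.

Lemma lmeasurable_box (a b : V) : measurable (box a b : set leboT).
Proof.
rewrite (_ : box a b = \bigcap_(i in [set: 'I_n.+1])
    ([set x : V | x ord0 i <= b ord0 i] `&` ~` [set x : V | x ord0 i <= a ord0 i])).
  apply: fin_bigcap_measurable => // i _; apply: measurableI.
    exact: lmeasurable_halfspace.
  by apply: measurableC; exact: lmeasurable_halfspace.
apply/seteqP; split => x /= h i.
  by move=> _; have /andP[ax xb] := h i; split => //; apply/negP; rewrite -ltNge.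
by have [xb /negP] := h i I; rewrite -ltNge => ->.
Qed.

Lemma lebm_box_lty (a b : V) : (lebm (box a b) < +oo)%E.
Proof. by apply: le_lt_trans (lebo_box_le _ _) _; rewrite ltry. Qed.

Lemma le_coord_norm (x : V) i : `|x ord0 i| <= `|x|.
Proof.
rewrite [leRHS]mx_normrE; exact: (le_bigmax _ (fun ij => `|x ij.1 ij.2|) (ord0, i)).
Qed.

Lemma lebm_sigma_finite : sigma_finite setT lebm.
Proof.
exists (fun k => box (const_mx (- k%:R)) (const_mx k%:R)).
  apply/esym/seteqP; split => // x _.
  exists (Num.truncn `|x|).+1 => // i; rewrite !mxE.
  have := truncnS_gt `|x|; have := le_coord_norm x i; rewrite ler_norml.
  by move=> /andP[? ?] ?; apply/andP; split; lra.
by move=> k; split; [exact: lmeasurable_box|exact: lebm_box_lty].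
Qed.

HB.instance Definition _ := Measure_isSigmaFinite.Build _ leboT R lebm
  lebm_sigma_finite.

Lemma lmeasurable_open (U : set V) : open U -> measurable (U : set leboT).
Proof.
move=> oU.
(* An open set is the union of the boxes with rational corners that it contains, and these are
   countably many. *)
pose B (ab : 'rV[rat]_n.+1 * 'rV[rat]_n.+1) : set V :=
  box (map_mx ratr ab.1) (map_mx ratr ab.2).
rewrite (_ : U = \bigcup_ab (if `[< B ab `<=` U >] then B ab else set0)).
  apply: countable_bigcupT_measurable => // ab.
  by case: ifP => _ //; exact: lmeasurable_box.
apply/seteqP; split => x; last first.
  by move=> [ab _]; case: asboolP => // h /h.
move=> Ux; have /nbhs_ballP[e /= e0 xeU] := open_nbhs_nbhs (conj oU Ux).
have /choice[a aP] : forall i : 'I_n.+1, exists q : rat,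
    ratr q \in `]x ord0 i - e, x ord0 i[ by move=> i; apply: rat_in_itvoo; lra.
have /choice[b bP] : forall i : 'I_n.+1, exists q : rat,
    ratr q \in `]x ord0 i, x ord0 i + e[ by move=> i; apply: rat_in_itvoo; lra.
exists (\row_i a i, \row_i b i) => //.
rewrite asboolT.
  move=> i; rewrite !mxE.
  by have := aP i; have := bP i; rewrite !in_itv/= => /andP[? ?] /andP[? ?]; lra.
move=> y By; apply: xeU; split => // i j; rewrite ord1.
have := By j; rewrite !mxE /ball/= => yab.
have := aP j; have := bP j; rewrite !in_itv/= => /andP[? ?] /andP[? ?].
by rewrite ltr_norml; lra.
Qed.

Lemma continuous_lmeasurable (f : V -> R) : continuous f ->
  measurable_fun [set: leboT] (f : leboT -> R).
Proof.
move=> cf; apply: (measurability (@RGenOpens.G R)) => [|_ [_ [a [b ->]] <-]].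
  exact: RGenOpens.measurableE.
rewrite setTI; apply: lmeasurable_open; exact: open_comp.
Qed.

Lemma continuous_lmeasurable_fun (f : V -> R) : continuous f -> lmeasurable_fun f.
Proof.
move=> cf a; apply: lmeasurable_open.
rewrite (_ : [set x | _] = f @^-1` `]a, +oo[%classic); last first.
  by apply/seteqP; split => x /=; rewrite in_itv/= andbT.
exact: open_comp.
Qed.

End lebo_measurable.

(** * The layer-cake integral as a Lebesgue integral *)

Section integral_on_Rd.
Context {R : realType} {n : nat}.
Local Notation V := 'rV[R]_n.+1.
Local Notation T := (@leboT R n).
Local Notation mu := (@lebm R n).
Implicit Types (f g : V -> R) (r M : R).

(** Tonelli for the indicator of the region [0 < t < f x]: integrating in [t] first gives [f x],
    integrating in [x] first gives the measure of the superlevel set. *)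
Lemma layer_cake f : (forall x, 0 <= f x) -> measurable_fun [set: T] (f : T -> R) ->
  intd f = (\int[mu]_x (f x)%:E)%E.
Proof.
move=> f0 mf.
pose F (p : T * R) : \bar R := (\1_(`]0, f p.1[%classic) p.2 : R)%:E.
have mF : measurable_fun setT F.
  apply/measurable_EFinP; apply: measurable_indic => /=.
  pose pos (p : T * R) := 0 < p.2.
  pose below (p : T * R) := p.2 < f p.1.
  rewrite [X in _ X](_ : _ = pos @^-1` [set true] `&` below @^-1` [set true]).
    apply: measurableI.
      have : measurable_fun setT pos by exact: measurable_fun_ltr.
      by move=> /(_ measurableT [set true]); rewrite setTI; exact.
    have : measurable_fun setT below.
      by apply: measurable_fun_ltr => //; exact: measurableT_comp.
    by move=> /(_ measurableT [set true]); rewrite setTI; exact.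
  by apply/seteqP; split => p; rewrite /= in_itv/= => /andP.
transitivity (\int[mu]_x \int[@lebesgue_measure R]_t F (x, t))%E; last first.
  apply: eq_integral => x _; rewrite /F/= integral_indic//= setIT.
  rewrite lebesgue_measure_itv/= lte_fin; have [fx|fx] := ltP 0 (f x).
    by rewrite oppr0 adde0.
  by congr EFin; apply/eqP; rewrite eq_le fx f0.
have F0 p : (0 <= F p)%E by rewrite lee_fin.
rewrite [RHS](fubini_tonelli (m1 := mu) (m2 := @lebesgue_measure R) F mF F0).
rewrite /intd integral_mkcond; apply: eq_integral => t _.
rewrite patchE /F/=; have [t0|t0] := ltP 0 t.
  rewrite mem_set; last by rewrite /Ipos/= in_itv/= t0.
  rewrite [RHS](_ : _ = (\int[mu]_x (\1_([set x | t < f x] : set T) x : R)%:E)%E).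
    rewrite integral_indic ?setIT//.
    rewrite (_ : [set x : T | _] = setT `&` f @^-1` `]t, +oo[%classic).
      exact: mf.
    by rewrite setTI; apply/seteqP; split => x /=; rewrite in_itv/= andbT.
  apply: eq_integral => x _; rewrite !indicE; congr ((_ _)%:R%:E).
  by apply/idP/idP; rewrite !inE/= in_itv/= t0.
rewrite memNset; last by rewrite /Ipos/= in_itv/= andbT; apply/negP; rewrite -leNgt.
rewrite integral0_eq// => x _; rewrite indicE memNset//= in_itv/= => /andP[].
by rewrite ltNge t0.
Qed.

Lemma rintdE f : mu.-integrable [set: T] (EFin \o f) ->
  rintd f = \int[mu]_x f x.
Proof.
move=> intf; have mf : measurable_fun [set: T] (f : T -> R).
  exact/measurable_EFinP/(measurable_int mu).
rewrite /Rintegral integralE fineB; last 2 first.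
  exact: integrable_pos_fin_num.
  exact: integrable_neg_fin_num.
rewrite /rintd !layer_cake; last 4 first.
- by move=> x; rewrite le_max lexx orbT.
- apply: measurable_maxr; last exact: measurable_cst.
  by apply: measurableT_comp; [exact: oppr_measurable|exact: mf].
- by move=> x; rewrite le_max lexx orbT.
- by apply: measurable_maxr; [exact: mf|exact: measurable_cst].
congr (fine _ - fine _); apply: eq_integral => x _.
  by rewrite funeposE/= EFin_max.
by rewrite funenegE/= EFin_max.
Qed.

(** The margin 1 compensates for boxes being open on the left: the closed ball of radius [r] has to
    fit inside. *)
Definition ball_box r : set V := box (const_mx (- (r + 1))) (const_mx (r + 1)).

Lemma ball_boxP r (x : V) : `|x| <= r -> ball_box r x.
Proof.
move=> xr i; have := le_coord_norm x i; rewrite ler_norml !mxE => /andP[? ?].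
by apply/andP; split; lra.
Qed.

Lemma integrable_ball_box M r :
  mu.-integrable [set: T] (fun x => M%:E * (\1_(ball_box r : set T) x : R)%:E)%E.
Proof.
have mB : measurable (ball_box r : set T) by exact: lmeasurable_box.
apply: integrableZl => //; apply/integrableP; split.
  by apply/measurable_EFinP; exact: measurable_indic.
under eq_integral do rewrite gee0_abs//.
by rewrite integral_indic// setIT; exact: lebm_box_lty.
Qed.

Lemma le_ball_box M r f x : (forall y, `|f y| <= M) ->
  (forall y, r < `|y| -> f y = 0) ->
  (`|(f x)%:E| <= M%:E * (\1_(ball_box r : set T) x : R)%:E)%E.
Proof.
move=> fM f0; rewrite indicE; have [xB|/negP xB] := boolP (x \in _).
  by rewrite mule1 lee_fin.
rewrite mule0 f0 ?abse0// ltNge; apply/negP => xr; apply: xB.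
by rewrite inE; exact: ball_boxP.
Qed.

Lemma integrable_bounded_support f r M :
  measurable_fun [set: T] (f : T -> R) ->
  (forall x, `|f x| <= M) -> (forall x, r < `|x| -> f x = 0) ->
  mu.-integrable [set: T] (EFin \o f).
Proof.
move=> mf fM f0.
have mEf : measurable_fun [set: T] (EFin \o f : T -> \bar R) by exact/measurable_EFinP.
apply: (le_integrable measurableT mEf _ (integrable_ball_box M r)).
by move=> x _; apply: le_trans (lee_abs _); exact: le_ball_box.
Qed.

Lemma continuous_bounded_support f r : continuous f ->
  (forall x, r < `|x| -> f x = 0) -> exists M, forall x, `|f x| <= M.
Proof.
move=> cf f0.
(* [r] may be negative; with its absolute value the cube is nonempty, as the extreme value theorem
   requires. *)
pose K : set V := [set x | forall i, x ord0 i \in `[- `|r|, `|r|]].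
have cK : compact K.
  apply: (@rV_compact _ _ (fun=> `[- `|r|, `|r|]%classic)) => _.
  exact: segment_compact.
have K0 : K !=set0 by exists 0 => i; rewrite mxE in_itv/= oppr_le0 normr_ge0.
have cnf : {within K, continuous (fun x => `|f x|)}.
  apply: continuous_subspaceT => x.
  by apply: continuous_comp; [exact: cf|exact: norm_continuous].
have [c _ cmax] := EVT_max_rV K0 cK cnf.
exists `|f c| => x; have [xK|xK] := boolP (x \in K); first exact: cmax.
rewrite f0 ?normr0// ltNge; apply/negP => xr; move/negP: xK; apply.
rewrite inE => i; rewrite in_itv/= -ler_norml.
by rewrite (le_trans (le_coord_norm _ _))// (le_trans xr)// ler_norm.
Qed.

Lemma continuous_integrable f r : continuous f ->
  (forall x, r < `|x| -> f x = 0) -> mu.-integrable [set: T] (EFin \o f).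
Proof.
move=> cf f0; have [M fM] := continuous_bounded_support _ _ cf f0.
apply: integrable_bounded_support fM f0; exact: continuous_lmeasurable.
Qed.

(** Translating covers gives one inequality for every vector; the converse is the same inequality
    for [-v]. *)
Lemma lebo_translate (v : V) (A : set V) : lebo [set x : V | A (x + v)] = lebo A.
Proof.
have H (u : V) B : (lebo [set x : V | B (x + u)%R] <= lebo B)%E.
  apply: le_ereal_inf_tmp => _ [[p q] /= Bpq <-].
  rewrite [leRHS](_ : _ = \sum_(k <oo) (boxvol (p k - u)%R (q k - u)%R)%:E)%E.
    apply: lebo_cover => x /Bpq[k _ xk]; exists k => // i.
    by have := xk i; rewrite !mxE/=; lra.
  apply: eq_eseriesr => k _; congr EFin; apply: eq_bigr => i _; rewrite !mxE.
  by congr Num.max; ring.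
apply/eqP; rewrite eq_le H/=.
rewrite [leLHS](_ : _ = lebo [set x : V | [set y : V | A (y + v)] (x - v)]).
  exact: H.
by congr lebo; apply/seteqP; split => x /=; rewrite subrK.
Qed.

Lemma rintd_translate f (v : V) : rintd (fun x => f (x + v)) = rintd f.
Proof.
have H g : intd (fun x => g (x + v)) = intd g.
  apply: eq_integral => t _; exact: (lebo_translate v [set x | t < g x]).
rewrite /rintd (H (fun x => Num.max (f x) 0)).
by rewrite (H (fun x => Num.max (- f x) 0)).
Qed.

End integral_on_Rd.

(** * Integration by parts and weak derivatives *)

Section directional_derivative.
Context {R : realType} {n : nat}.
Local Notation V := 'rV[R]_n.+1.
Local Notation T := (@leboT R n).
Local Notation mu := (@lebm R n).

Lemma is_deriveE (W : normedModType R) (f : W -> R) (a v : W) (df : R) :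
  is_derive a v f df <-> h^-1 *: (f (h *: v + a) - f a) @[h --> 0^'] --> df.
Proof.
split=> [[fav <-]|fdf]; first exact: fav.
by split; [apply/cvg_ex; exists df|exact: cvg_lim].
Qed.

Lemma is_derive_line (W : normedModType R) (f : W -> R) (a v : W) (t df : R) :
  is_derive (t *: v + a) v f df ->
  is_derive t (1 : R) (fun s => f (s *: v + a)) df.
Proof.
move=> /is_deriveE H; apply/is_deriveE; apply: cvg_trans H.
apply: near_eq_cvg; apply: nearW => h.
by rewrite addrA scalerDl; congr (_ *: (f (_ *: _ + _ + _) - _)); rewrite [RHS]mulr1.
Qed.

Lemma cvg_harmonic_dnbhs : (k.+1%:R^-1 : R) @[k --> \oo] --> (0 : R)^'.
Proof.
move=> A /= A0; have H := @cvg_harmonic R _ A0.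
apply: (filterS (F := \oo) (P := fun k => k.+1%:R^-1 != 0 :> R -> A k.+1%:R^-1)) => //.
by move=> k; apply; rewrite invr_eq0 pnatr_eq0.
Qed.

(** Mean value theorem on the segment from [x] to [h *: v + x]. The bound serves as dominating
    constant for difference quotients. *)
Lemma derive_quotient_bound (w w' : V -> R) (v x : V) (M h : R) : 0 < h ->
  (forall y, is_derive y v w (w' y)) -> (forall y, `|w' y| <= M) ->
  `|h^-1 * (w (h *: v + x) - w x)| <= M.
Proof.
move=> h0 dw w'M.
have dphi t : is_derive t (1 : R) (fun s => w (s *: v + x)) (w' (t *: v + x)).
  exact: is_derive_line.
have cphi : {within `[0, h], continuous (fun s => w (s *: v + x))}.
  by apply: derivable_within_continuous => t _; exact: ex_derive.
have [c _] := MVT h0 (fun t _ => dphi t) cphi.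
rewrite scale0r add0r subr0 => ->.
by rewrite mulrC mulfK ?gt_eqF.
Qed.

(** The difference quotients of [w] have integral 0 by translation invariance. They converge
    pointwise to [w'] and are bounded by [M] with support in a fixed box, so dominated convergence
    applies. *)
Lemma integral_derive_eq0 (w w' : V -> R) (v : V) (r : R) :
  continuous w -> continuous w' ->
  (forall x, is_derive x v w (w' x)) ->
  (forall x, r < `|x| -> w x = 0) -> (forall x, r < `|x| -> w' x = 0) ->
  \int[mu]_x w' x = 0.
Proof.
move=> cw cw' dw w0 w'0.
have [M w'M] := continuous_bounded_support _ _ cw' w'0.
pose F (k : nat) (x : V) : R := k.+1%:R * (w (k.+1%:R^-1 *: v + x) - w x).
have FM k x : `|F k x| <= M.
  have k0 : 0 < k.+1%:R^-1 :> R by rewrite invr_gt0.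
  by have := derive_quotient_bound w w' v x M _ k0 dw w'M; rewrite invrK.
have wsh k : continuous (fun x : V => w (k.+1%:R^-1 *: v + x)).
  move=> x; apply: continuous_comp; last exact: cw.
  by apply: continuousD; [exact: cst_continuous|].
(* The increments are at most 1, so a shift moves the support by at most the norm of [v]. *)
have wsh0 k x : r + `|v| < `|x| -> w (k.+1%:R^-1 *: v + x) = 0.
  move=> rx; apply: w0.
  have := ler_normB (k.+1%:R^-1 *: v + x) (k.+1%:R^-1 *: v).
  rewrite addrAC subrr add0r normrZ ger0_norm ?invr_ge0//.
  have : k.+1%:R^-1 * `|v| <= `|v|.
    by rewrite ler_piMl// invf_le1// ler1n.
  move=> kv xkv; rewrite -(ltrD2r `|v|); apply: (lt_le_trans rx).
  by apply: (le_trans xkv); rewrite lerD2l.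
have F0 k x : r + `|v| < `|x| -> F k x = 0.
  move=> rx; rewrite /F wsh0// w0 ?subrr ?mulr0//.
  by apply: le_lt_trans rx; rewrite lerDl.
have cF k : continuous (F k).
  move=> x; exact: (cvgM (cvg_cst (k.+1%:R : R)) (cvgB (wsh k x) (cw x))).
have intF k : \int[mu]_x F k x = 0.
  have iw : mu.-integrable [set: T] (EFin \o w) by exact: continuous_integrable w0.
  have iws : mu.-integrable [set: T] (EFin \o (fun x : V => w (k.+1%:R^-1 *: v + x))).
    by apply: continuous_integrable (wsh0 k).
  rewrite /F RintegralZl//; last first.
    by have := integrableB measurableT iws iw; apply: eq_integrable.
  rewrite RintegralB// -(rintdE _ iw) -(rintdE _ iws).
  rewrite (_ : (fun x => _) = fun x => w (x + k.+1%:R^-1 *: v)); last first.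
    by apply/funext => x; rewrite addrC.
  by rewrite rintd_translate subrr mulr0.
have ae_cvg : {ae mu, forall x, [set: T] x ->
    (F k x)%:E @[k --> \oo] --> (w' x)%:E}.
  apply: aeW => x _; apply: cvg_EFin; first exact: nearW.
  have /is_deriveE dwx := dw x.
  have := cvg_comp _ _ cvg_harmonic_dnbhs dwx; apply: cvg_trans.
  by apply: near_eq_cvg; apply: nearW => k /=; rewrite invrK.
have mEF (f : V -> R) : continuous f -> measurable_fun [set: T] (EFin \o f : T -> \bar R).
  by move=> cf; apply/measurable_EFinP; exact: continuous_lmeasurable.
have rv : r <= r + `|v| by rewrite lerDl.
have bound : {ae mu, forall x k, [set: T] x -> (`|(F k x)%:E| <=
    M%:E * (\1_(ball_box (r + `|v|) : set T) x : R)%:E)%E}.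
  by apply: aeW => x k _; apply: le_ball_box; [exact: FM|exact: F0].
have [_ _] := dominated_convergence measurableT
  (fun k => mEF _ (cF k)) (mEF _ cw') ae_cvg (integrable_ball_box M (r + `|v|))
  bound.
rewrite (_ : (fun k => _) = cst 0%E); last first.
  apply/funext => k; rewrite -[RHS]/(0%:E) -(intF k) /Rintegral fineK//.
  apply: (integrable_fin_num measurableT).
  by have := continuous_integrable _ _ (cF k) (F0 k).
move=> H; rewrite /Rintegral (_ : (\int[mu]_x (w' x)%:E)%E = 0%E)//.
exact: (cvg_unique (@ereal_hausdorff R) H (cvg_cst _)).
Qed.

(** The two integrands add up to the derivative of [u * phi], which vanishes outside a ball because
    [u] does; its integral is 0. *)
Lemma rintd_by_parts (u u' phi phi' : V -> R) (v : V) (r : R) :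
  continuous u -> continuous u' -> continuous phi -> continuous phi' ->
  (forall x, is_derive x v u (u' x)) -> (forall x, is_derive x v phi (phi' x)) ->
  (forall x, r < `|x| -> u x = 0) -> (forall x, r < `|x| -> u' x = 0) ->
  rintd (fun x => u x * phi' x) = - rintd (fun x => u' x * phi x).
Proof.
move=> cu cu' cp cp' du dp u0 u'0.
have cM (f g : V -> R) : continuous f -> continuous g -> continuous (fun x => f x * g x).
  by move=> cf cg x; exact: (cvgM (cf x) (cg x)).
have i1 : mu.-integrable [set: T] (EFin \o (fun x => u x * phi' x)).
  apply: (continuous_integrable _ r); first exact: cM.
  by move=> x /u0 ->; rewrite mul0r.
have i2 : mu.-integrable [set: T] (EFin \o (fun x => u' x * phi x)).
  apply: (continuous_integrable _ r); first exact: cM.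
  by move=> x /u'0 ->; rewrite mul0r.
apply/eqP; rewrite -addr_eq0 !rintdE// -RintegralD//; apply/eqP.
apply: (@integral_derive_eq0 (fun x => u x * phi x) _ v r).
- exact: cM.
- by move=> x; exact: (cvgD (cM _ _ cu cp' x) (cM _ _ cu' cp x)).
- move=> x; have := du x; have := dp x => dpx dux.
  have H : is_derive x v (u * phi) (u x *: phi' x + phi x *: u' x).
    exact: is_deriveM.
  by apply: (is_derive_eq H); rewrite /GRing.scale/= [phi x * _]mulrC.
- by move=> x /u0 ->; rewrite mul0r.
- by move=> x rx; rewrite u0// u'0// !mul0r addr0.
Qed.

Lemma locint_continuous (u : V -> R) (r : R) : continuous u ->
  (forall x, r < `|x| -> u x = 0) -> locint u.
Proof.
move=> cu u0; split; first exact: continuous_lmeasurable_fun.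
move=> s s0; set f : V -> R := fun x => if `|x| <= s then `|u x| else 0.
have mf : measurable_fun [set: T] (f : T -> R).
  have mnorm : measurable_fun [set: T] (fun x : T => `|x : V|).
    by apply: continuous_lmeasurable; exact: norm_continuous.
  have mnu : measurable_fun [set: T] (fun x : T => `|u x|).
    apply: measurableT_comp; first exact: normr_measurable.
    exact: continuous_lmeasurable.
  apply: measurable_fun_ifT; [|exact: mnu|exact: measurable_cst].
  by apply: measurable_fun_ler; [exact: mnorm|exact: measurable_cst].
have [M uM] := continuous_bounded_support _ _ cu u0.
have intf : mu.-integrable [set: T] (EFin \o f).
  apply: (integrable_bounded_support f r M mf) => x.
    by rewrite /f; case: ifP => _; rewrite ?normr_id// normr0 (le_trans _ (uM x)).
  by move=> /u0; rewrite /f => ->; rewrite normr0 if_same.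
rewrite layer_cake//; last by move=> x; rewrite /f; case: ifP.
by have /integrable_lty := intf; exact.
Qed.

Lemma testfun_is_derive (phi : V -> R) (s : seq 'I_n.+1) (i : 'I_n.+1) (x : V) :
  testfun phi -> is_derive x (ee R i) (iterpd s phi) (iterpd (i :: s) phi x).
Proof. by move=> [sm _]; apply: derivableP; exact: (sm s).2. Qed.

Lemma W21loc_C2 (u : V -> R) (Du : 'I_n.+1 -> V -> R)
    (D2u : 'I_n.+1 -> 'I_n.+1 -> V -> R) (r : R) :
  continuous u -> (forall i, continuous (Du i)) ->
  (forall i j, continuous (D2u i j)) ->
  (forall i x, is_derive x (ee R i) u (Du i x)) ->
  (forall i j x, is_derive x (ee R j) (Du i) (D2u i j x)) ->
  (forall x, r < `|x| -> u x = 0) ->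
  (forall i x, r < `|x| -> Du i x = 0) ->
  (forall i j x, r < `|x| -> D2u i j x = 0) ->
  W21loc u Du D2u.
Proof.
move=> cu cDu cD2u du dDu u0 Du0 D2u0; split; first exact: locint_continuous u0.
have ct (phi : V -> R) s : testfun phi -> continuous (iterpd s phi).
  by move=> [sm _]; exact: (sm s).1.
have dt (phi : V -> R) s (i : 'I_n.+1) (x : V) : testfun phi ->
    is_derive x (ee R i) (iterpd s phi) (iterpd (i :: s) phi x).
  by move=> tphi; apply: testfun_is_derive.
split=> [i|i j]; split.
- exact: (locint_continuous _ r (cDu i) (Du0 i)).
- move=> phi tphi; rewrite expr1 mulN1r.
  exact: (rintd_by_parts u (Du i) phi _ (ee R i) r cu (cDu i)
    (ct phi [::] tphi) (ct phi [:: i] tphi) (du i) (dt phi [::] i ^~ tphi)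
    u0 (Du0 i)).
- exact: (locint_continuous _ r (cD2u i j) (D2u0 i j)).
- move=> phi tphi; rewrite sqrrN expr1n mul1r.
  (* In [iterpd [:: i; j] phi] the outer derivative is the one in direction [i]. It is moved first,
     producing [Du i]; the one in direction [j] then produces [D2u i j]. *)
  rewrite (rintd_by_parts u (Du i) (iterpd [:: j] phi) _ (ee R i) r cu (cDu i)
    (ct phi [:: j] tphi) (ct phi [:: i; j] tphi) (du i) (dt phi [:: j] i ^~ tphi)
    u0 (Du0 i)).
  rewrite (rintd_by_parts (Du i) (D2u i j) phi _ (ee R j) r (cDu i) (cD2u i j)
    (ct phi [::] tphi) (ct phi [:: j] tphi) (dDu i j) (dt phi [::] j ^~ tphi)
    (Du0 i) (D2u0 i j)).
  by rewrite opprK.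
Qed.

End directional_derivative.

(** * Bump functions *)

Section bump_profile.
Context {R : realType}.
Implicit Types (t y p s : R) (a : nat).

Let pos y : R := Num.max y 0.

(** The remainder of the first-order expansion is at most [h ^+ 2] in every sign case, also across
    0. *)
Let is_derive_pos2 y : is_derive y (1 : R) (fun y => pos y ^+ 2) (2 * pos y).
Proof.
apply/is_deriveE/cvgrPdist_le => e e0; near=> h.
have h0 : h != 0 by near: h; exact: nbhs_dnbhs_neq.
have he : `|h| <= e by near: h; exact: dnbhs0_le.
apply: le_trans he.
have -> : 2 * pos y - h^-1 *: (pos (h *: 1 + y) ^+ 2 - pos y ^+ 2) =
    h^-1 * (2 * pos y * h - (pos (h + y) ^+ 2 - pos y ^+ 2)).
  by rewrite /GRing.scale/= mulr1; field.
rewrite normrM normfV ler_pdivrMl ?normr_gt0// -expr2 real_normK ?num_real//.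
by rewrite ler_norml /pos; case: (leP y 0) => ?; case: (leP (h + y) 0) => ?;
  apply/andP; split; nra.
Unshelve. all: by end_near. Qed.

Let parab t : R := t * (1 - t).

Let is_derive_parab t : is_derive t (1 : R) parab (1 - 2 * t).
Proof.
have H : is_derive t (1 : R) ((id : R -> R) * (cst 1 - id)) (t *: (0 - 1) + (1 - t) *: 1).
  exact: is_deriveM.
by apply: (is_derive_eq H); rewrite /GRing.scale/=; ring.
Qed.

Let is_derive_pos2_parab t :
  is_derive t (1 : R) (fun t => pos (parab t) ^+ 2) (2 * pos (parab t) * (1 - 2 * t)).
Proof.
have H := is_derive1_comp (is_derive_pos2 (parab t)) (is_derive_parab t).
by apply: (is_derive_eq H); rewrite /GRing.scale/=; ring.
Qed.

(* [profile a] is the [a]-th derivative of [(max(t(1-t),0))^3 / 2]. *)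
Definition profile a t : R :=
  match a with
  | 0 => 2^-1 * Num.max (t * (1 - t)) 0 ^+ 3
  | 1 => 3 / 2 * (Num.max (t * (1 - t)) 0 ^+ 2 * (1 - 2 * t))
  | _ => 3 * (Num.max (t * (1 - t)) 0 * (1 - 2 * t) ^+ 2) -
         3 * Num.max (t * (1 - t)) 0 ^+ 2
  end.

(** Differentiating the cube is thereby reduced to differentiating the square, the only step that
    meets the kink of [pos]. *)
Let pos3E y : pos y ^+ 3 = y * pos y ^+ 2.
Proof. by rewrite /pos; case: leP => ?; rewrite ?expr0n/= ?mulr0// exprS. Qed.

Lemma is_derive_profile a t : (a < 2)%N ->
  is_derive t (1 : R) (profile a) (profile a.+1 t).
Proof.
case: a => [|[|//]] _.
  have H : is_derive t (1 : R) (parab * (fun t => pos (parab t) ^+ 2))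
    (parab t *: (2 * pos (parab t) * (1 - 2 * t)) + pos (parab t) ^+ 2 *: (1 - 2 * t)).
    exact: is_deriveM.
  rewrite (_ : profile 0 = 2^-1 \*: (parab * (fun t => pos (parab t) ^+ 2))).
    apply: (is_derive_eq (is_deriveZ 2^-1 H)); rewrite /profile.
    rewrite /GRing.scale/= -/(parab t) -/(pos (parab t)).
    rewrite /pos; case: (leP (parab t) 0) => ?; last by field.
    by rewrite !(mulr0, mul0r, expr0n)/=; ring.
  by apply/funext => x; rewrite /= -[Num.max _ _]/(pos (parab x)) pos3E.
have H2 : is_derive t (1 : R) (cst 1 - (2 \*: (id : R -> R))) (0 - 2 *: 1).
  exact: is_deriveB.
have H : is_derive t (1 : R) ((fun t => pos (parab t) ^+ 2) * (cst 1 - (2 \*: (id : R -> R))))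
    (pos (parab t) ^+ 2 *: (0 - 2 *: 1) +
     (cst 1 - (2 \*: (id : R -> R))) t *: (2 * pos (parab t) * (1 - 2 * t))).
  exact: is_deriveM.
apply: (is_derive_eq (is_deriveZ (3 / 2) H)).
have -> : (cst 1 - (2 \*: (id : R -> R))) t = 1 - 2 * t by [].
rewrite /profile -/(parab t) -/(pos (parab t)) /GRing.scale/=; set w := pos _.
by field.
Qed.

Lemma continuous_profile a : continuous (profile a).
Proof.
have dc b : (b < 2)%N -> continuous (profile b).
  move=> b2 t; apply: differentiable_continuous; apply/derivable1_diffP.
  by have := is_derive_profile b t b2.
case: a => [|[|a]]; [exact: dc|exact: dc|].
have cp : continuous parab.
  move=> t; apply: differentiable_continuous; apply/derivable1_diffP.
  by have := is_derive_parab t.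
have cpos : continuous (fun t => pos (parab t)).
  have -> : (fun t => pos (parab t)) = (fun t => (parab t + `|parab t|) * 2^-1).
    by apply/funext => t; rewrite /pos; case: leP => ?;
      [rewrite ler0_norm// addrN mul0r|rewrite gtr0_norm//; field].
  move=> t; exact: (cvgM (cvgD (cp t) (cvg_norm (cp t))) (cvg_cst _)).
have clin : continuous (fun t : R => 1 - 2 * t).
  by move=> t; apply: (cvgB (cvg_cst _)); apply: (cvgM (cvg_cst _)).
move=> t; rewrite /profile /=.
apply: cvgB; apply: (cvgM (cvg_cst _)).
  exact: (cvgM (cpos t) (cvgM (clin t) (clin t))).
exact: (cvgM (cpos t) (cpos t)).
Qed.

Lemma profile_support a t : ~~ (0 < t < 1) -> profile a t = 0.
Proof.
move=> t01; have tq : t * (1 - t) <= 0.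
  by move: t01; rewrite negb_and -!leNgt => /orP[] ?; nra.
by case: a => [|[|a]]; rewrite /profile max_r// expr0n/= !(mulr0, mul0r, subr0).
Qed.

(** On the support [q = t * (1 - t)] is at most 1/4 and [(1 - 2 * t) ^+ 2] at most 1. One bound for
    all orders makes a derivative of a bump cost exactly its power of [s^-1]. *)
Lemma profile_bound a t : `|profile a t| <= 1.
Proof.
have [t01|] := boolP (0 < t < 1); last by move=> /profile_support ->; rewrite normr0.
have /andP[t0 t1] := t01.
have tq : 0 <= t * (1 - t) by nra.
set q := t * (1 - t) in tq *; have q4 : q <= 4^-1.
  by have := sqr_ge0 (t - 2^-1); rewrite /q; nra.
have q2 : q ^+ 2 <= 4^-1 by nra.
have l2 : (1 - 2 * t) ^+ 2 <= 1 by nra.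
have q20 : 0 <= q ^+ 2 by exact: sqr_ge0.
have l20 : 0 <= (1 - 2 * t) ^+ 2 by exact: sqr_ge0.
rewrite ler_norml; case: a => [|[|a]]; rewrite /profile -/q max_l//.
- have : q * q ^+ 2 <= 4^-1 * 4^-1 by exact: ler_pM.
  have : 0 <= q * q ^+ 2 by exact: mulr_ge0.
  by rewrite exprS; lra.
- have : 0 <= q ^+ 2 * t by apply: mulr_ge0 => //; exact: ltW.
  have : 0 <= q ^+ 2 * (1 - t) by apply: mulr_ge0 => //; lra.
  by rewrite mulrBr mulr1 mulrBr mulr1 mulrCA; lra.
- have : q * (1 - 2 * t) ^+ 2 <= 4^-1 * 1 by exact: ler_pM.
  have : 0 <= q * (1 - 2 * t) ^+ 2 by exact: mulr_ge0.
  by lra.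
Qed.

(** The interval []1/4, 3/8]] stays away from 0, where the profile vanishes, and from 1/2, where its
    derivative does. Its length 1/8 is the source of the later powers of 8, and it is half-open to
    match [box]. *)
Definition profile_lower_bound (c : R) :=
  0 < c /\ forall a t, (a < 2)%N -> 4^-1 < t <= 3 / 8 -> c <= profile a t.

Lemma profile_lower_bound_ex : exists c, profile_lower_bound c.
Proof.
(* On this interval [t * (1 - t) >= 3/16] and [1 - 2 * t >= 1/4]. The two values are thus at least
   [(3/16)^3 / 2] and [(3/2) (3/16)^2 / 4], both above 1/512. *)
exists 512^-1; split=> [|a t a2 /andP[t0 t1]]; first by rewrite invr_gt0 ltr0n.
have q1 : 3 / 16 <= t * (1 - t) by nra.
set q := t * (1 - t) in q1 *.
have q2 : (3 / 16) ^+ 2 <= q ^+ 2 by rewrite lerXn2r ?nnegrE//; lra.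
have q3 : (3 / 16) ^+ 3 <= q ^+ 3 by rewrite lerXn2r ?nnegrE//; lra.
case: a a2 => [|[|//]] _; rewrite /profile -/q max_l; try lra.
have : (3 / 16) ^+ 2 * 4^-1 <= q ^+ 2 * (1 - 2 * t) :> R by apply: ler_pM => //; lra.
by lra.
Qed.

End bump_profile.

(** * Sums of bumps on disjoint cubes *)

Section bump_sums.
Context {R : realType} {n : nat}.
Local Notation V := 'rV[R]_n.+1.
Local Notation I := 'I_n.+1.
Implicit Types (p s : R) (m : I -> nat) (x : V).

(* The partial derivative of multi-order [m] of
   [x |-> \prod_k profile 0 ((x_k - p) / s)]. *)
Definition bump m p s x : R :=
  \prod_k (s^-1 ^+ m k * profile (m k) ((x ord0 k - p) / s)).

Definition incr m (i : I) : I -> nat := fun k => (m k + (k == i))%N.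

(** Along [ee R i] only the [i]-th factor varies, and the chain rule supplies the additional [s^-1].
    The bound on [m i] reflects that the profile is differentiated at most twice. *)
Lemma is_derive_bump m p s i x : (m i < 2)%N ->
  is_derive x (ee R i) (bump m p s) (bump (incr m i) p s x).
Proof.
move=> mi; apply/is_deriveE.
pose P := \prod_(k | k != i) (s^-1 ^+ m k * profile (m k) ((x ord0 k - p) / s)).
have bE h : bump m p s (h *: ee R i + x) =
    s^-1 ^+ m i * profile (m i) ((h *: 1 + x ord0 i - p) / s) * P.
  rewrite /bump (bigD1 i)//= !mxE !eqxx/= mulr1 scaler1; congr (_ * _).
  by apply: eq_bigr => k ki; rewrite !mxE (negbTE ki) andbF mulr0 add0r.
have bE0 : bump m p s x = s^-1 ^+ m i * profile (m i) ((x ord0 i - p) / s) * P.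
  by rewrite /bump (bigD1 i).
have -> : bump (incr m i) p s x =
    s^-1 ^+ (m i).+1 * profile (m i).+1 ((x ord0 i - p) / s) * P.
  rewrite /bump (bigD1 i)//= /incr eqxx addn1; congr (_ * _).
  by apply: eq_bigr => k ki; rewrite (negbTE ki) addn0.
pose aff (t : R) := (t - p) / s.
have daff : is_derive (x ord0 i) (1 : R) aff s^-1.
  have H : is_derive (x ord0 i) (1 : R) (s^-1 \*: ((id : R -> R) - cst p)) (s^-1 *: (1 - 0)).
    by apply: is_deriveZ; exact: is_deriveB.
  rewrite (_ : aff = s^-1 \*: ((id : R -> R) - cst p)).
    by apply: (is_derive_eq H); rewrite subr0 /GRing.scale/= mulr1.
  by apply/funext => t; rewrite /aff mulrC.
have dprofile := is_derive_profile (m i) (aff (x ord0 i)) mi.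
have /is_deriveE H := is_derive1_comp dprofile daff.
pose G (t : R) := s^-1 ^+ m i * P * (t^-1 *:
  ((profile (m i) \o aff) (t *: 1 + x ord0 i) - (profile (m i) \o aff) (x ord0 i))).
have K : G @ (0 : R)^' --> s^-1 ^+ m i * P * (profile (m i).+1 (aff (x ord0 i)) * s^-1).
  exact: (cvgM (cvg_cst _) H).
rewrite (_ : s^-1 ^+ (m i).+1 * _ * P =
    s^-1 ^+ m i * P * (profile (m i).+1 (aff (x ord0 i)) * s^-1)); last first.
  by rewrite exprS -/(aff (x ord0 i)); ring.
rewrite (_ : (fun t => _) = G)//; apply/funext => t.
by rewrite /G bE bE0 /GRing.scale/= /aff; ring.
Qed.

Lemma continuous_bump m p s : continuous (bump m p s).
Proof.
have H (r : seq I) : continuous (fun x : V =>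
    \prod_(k <- r) (s^-1 ^+ m k * profile (m k) ((x ord0 k - p) / s))).
  elim: r => [|k r IH] y.
    by under eq_fun do rewrite big_nil; exact: cst_continuous.
  under eq_fun do rewrite big_cons.
  have cp : continuous_at y (fun x : V => profile (m k) ((x ord0 k - p) / s)).
    apply: (@continuous_comp V R R (fun x : V => (x ord0 k - p) / s) (profile (m k))).
      exact: (cvgM (cvgB (@coord_continuous R 1 n.+1 ord0 k y) (cvg_cst p)) (cvg_cst s^-1)).
    exact: continuous_profile.
  exact: (cvgM (cvgM (cvg_cst (s^-1 ^+ m k)) cp) (IH y)).
exact: H.
Qed.

Lemma bump_support m p s x : 0 < s -> bump m p s x != 0 ->
  forall k, p < x ord0 k < p + s.
Proof.
move=> s0 /prodf_neq0 b0 k; have := b0 k isT; rewrite mulf_eq0 negb_or => /andP[_].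
apply: contraNT => h; apply/eqP/profile_support; apply: contra h.
by rewrite ltr_pdivlMr// ltr_pdivrMr// mul0r mul1r; lra.
Qed.

Lemma bump_bound m p s x : 0 < s -> `|bump m p s x| <= s^-1 ^+ \sum_k m k.
Proof.
move=> s0; rewrite -prodrXr normr_prod; apply: ler_prod => k _.
have sm : 0 <= s^-1 ^+ m k by rewrite exprn_ge0// invr_ge0 ltW.
rewrite normr_ge0/= normrM (ger0_norm sm) -[leRHS]mulr1.
by apply: ler_wpM2l => //; exact: profile_bound.
Qed.

Lemma bump_lower c m p s x : profile_lower_bound c -> 0 < s ->
  (forall k, m k < 2)%N ->
  (forall k, p + s / 4 < x ord0 k <= p + s * (3 / 8)) ->
  c ^+ n.+1 * s^-1 ^+ (\sum_k m k) <= bump m p s x.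
Proof.
move=> [c0 cP] s0 m2 xk; rewrite -prodrXr.
have -> : c ^+ n.+1 = \prod_(k < n.+1) c by rewrite prodr_const card_ord.
rewrite -big_split/=; apply: ler_prod => k _.
have sm : 0 <= s^-1 ^+ m k by rewrite exprn_ge0// invr_ge0 ltW.
rewrite (mulr_ge0 (ltW c0) sm) andTb mulrC; apply: (ler_wpM2l sm).
apply: cP; first exact: m2.
rewrite ltr_pdivlMr// ler_pdivrMr//.
by have := xk k; lra.
Qed.

Variables (N : nat) (h s : 'I_N -> R).
Hypotheses (h0 : forall j, 0 < h j) (s0 : forall j, 0 < s j) (s1 : forall j, s j <= 1).

(** The [j]-th bump has height factor [h j] and sits on the cube with lower corner [(j, ..., j)] and
    side [s j]; [m] is the order of differentiation. *)
Definition bumps m x : R := \sum_j h j * bump m j%:R (s j) x.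

Definition cube (j : 'I_N) : set V := box (const_mx j%:R) (const_mx (j%:R + s j)).

(** The first coordinate alone decides: it lies in []j, j + s j]], and [s j <= 1]. *)
Lemma cube_disjoint (i j : 'I_N) x : cube i x -> cube j x -> i = j.
Proof.
move=> /(_ ord0) xi /(_ ord0) xj; apply/val_inj/eqP; rewrite eqn_leq.
move: xi xj; rewrite !mxE => /andP[xi1 xi2] /andP[xj1 xj2].
have := s1 i; have := s1 j => sj si.
by rewrite -[(i <= j)%N]ltnS -[(j <= i)%N]ltnS -!(ltr_nat R) -!natr1; apply/andP; split; lra.
Qed.

Lemma bump_cube m (j : 'I_N) x : bump m j%:R (s j) x != 0 -> cube j x.
Proof.
by move=> /(bump_support _ _ _ _ (s0 j)) xj k; rewrite !mxE; have := xj k; lra.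
Qed.

Lemma bumps_cube m (j : 'I_N) x : cube j x -> bumps m x = h j * bump m j%:R (s j) x.
Proof.
move=> xj; rewrite /bumps (bigD1 j)//= big1 ?addr0// => i ij.
apply/eqP; rewrite mulf_eq0; apply/orP; right; apply: contraNT ij => /bump_cube xi.
by apply/eqP; exact: cube_disjoint xi xj.
Qed.

Lemma bumps_out m x : (forall j, ~ cube j x) -> bumps m x = 0.
Proof.
move=> xj; rewrite /bumps big1// => i _.
apply/eqP; rewrite mulf_eq0; apply/orP; right; apply/negPn/negP => /bump_cube.
exact: xj.
Qed.

Lemma bumps_far m x : N%:R + 1 < `|x| -> bumps m x = 0.
Proof.
move=> xN; apply: bumps_out => j xj; move: xN; rewrite ltNge => /negP; apply.
rewrite [leLHS]mx_normrE; apply: bigmax_le => [|[i k] _ /=]; first by rewrite addr_ge0.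
rewrite ord1; have := xj k; rewrite !mxE => /andP[].
have jN : j%:R + 1 <= N%:R :> R by rewrite natr1 ler_nat ltn_ord.
have j0 : 0 <= j%:R :> R by [].
by have := s1 j; rewrite ler_norml; lra.
Qed.

Lemma continuous_bumps m : continuous (bumps m).
Proof.
move=> x; rewrite /bumps.
have H (r : seq 'I_N) : continuous (fun x : V => \sum_(j <- r) h j * bump m j%:R (s j) x).
  elim: r => [|k r IH] y.
    by under eq_fun do rewrite big_nil; exact: cst_continuous.
  under eq_fun do rewrite big_cons.
  exact: (cvgD (cvgM (cvg_cst (h k)) (@continuous_bump m k%:R (s k) y)) (IH y)).
exact: H.
Qed.

Lemma is_derive_bumps m i x : (m i < 2)%N ->
  is_derive x (ee R i) (bumps m) (bumps (incr m i) x).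
Proof.
move=> mi.
have H : is_derive x (ee R i) (\sum_(j < N) (h j \*: bump m j%:R (s j)))
    (\sum_(j < N) (h j *: bump (incr m i) j%:R (s j) x)).
  by apply: is_derive_sum => j; apply: is_deriveZ; exact: is_derive_bump.
rewrite (_ : bumps m = \sum_(j < N) (h j \*: bump m j%:R (s j)))//.
by apply/funext => y; rewrite fct_sumE.
Qed.

Let m0 : I -> nat := fun=> 0%N.

Lemma W21loc_bumps : W21loc (bumps m0) (fun i => bumps (incr m0 i))
  (fun i j => bumps (incr (incr m0 i) j)).
Proof.
apply: (W21loc_C2 _ _ _ (N%:R + 1)).
- exact: continuous_bumps.
- by move=> i; exact: continuous_bumps.
- by move=> i j; exact: continuous_bumps.
- by move=> i x; exact: is_derive_bumps.
- by move=> i j x; apply: is_derive_bumps; rewrite /incr; case: eqP.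
- by move=> x; exact: bumps_far.
- by move=> i x; exact: bumps_far.
- by move=> i j x; exact: bumps_far.
Qed.

Lemma sum_incr m i : (\sum_k incr m i k = (\sum_k m k).+1)%N.
Proof.
rewrite /incr big_split/= -[RHS]addn1; congr addn.
by rewrite (bigD1 i)//= eqxx big1// => k /negbTE ->.
Qed.

(** As [sigma >= 0], the superlevel set avoids the complement of the cubes, and it is covered by
    those with [sigma < c j]. Serves both the function and its Hessian. *)
Lemma lebo_cubes_le (F : V -> R) (c : 'I_N -> R) (sigma : R) : 0 <= sigma ->
  (forall j x, cube j x -> `|F x| <= c j) ->
  (forall x, (forall j, ~ cube j x) -> F x = 0) ->
  (lebo [set x | (sigma < `|F x|)%R] <= (\sum_(j | sigma < c j) s j ^+ n.+1)%:E)%E.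
Proof.
move=> sg0 Fc F0.
rewrite (eq_bigr (fun j : 'I_N => boxvol (const_mx j%:R) (const_mx (j%:R + s j) : V))).
  apply: le_trans (lebo_bigsetU_box_le _ _ _ _ _); apply: le_lebo => x /= sF.
  have [j xj] : exists j, cube j x.
    by apply: contrapT => /forallNP /F0 Fx; move: sF; rewrite Fx normr0 ltNge sg0.
  rewrite (bigD1 j)/=; last exact: lt_le_trans sF (Fc _ _ xj).
  by left.
move=> j _; rewrite /boxvol (eq_bigr (fun=> s j)) ?prodr_const ?card_ord// => i _.
by rewrite !mxE addrC addKr max_l// ltW.
Qed.

(** The part of the cube where every rescaled coordinate lies in []1/4, 3/8]], so that
    [profile_lower_bound] applies; its side is [s j / 8]. *)
Definition subcube (j : 'I_N) : set V :=
  box (const_mx (j%:R + s j / 4)) (const_mx (j%:R + s j * (3 / 8))).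

Lemma lebo_subcubes_ge (F : V -> R) (c : 'I_N -> R) (sigma : R) :
  (forall j x, subcube j x -> c j <= `|F x|) ->
  ((\sum_(j | sigma < c j) (s j / 8) ^+ n.+1)%:E <= lebo [set x | (sigma < `|F x|)%R])%E.
Proof.
move=> Fc.
rewrite (eq_bigr (fun j : 'I_N => boxvol (const_mx (j%:R + s j / 4))
    (const_mx (j%:R + s j * (3 / 8)) : V))).
  rewrite -big_filter; apply: lebo_ge_disjoint_boxes.
  - by rewrite filter_uniq// index_enum_uniq.
  - move=> j x; rewrite mem_filter => /andP[sc _] xj.
    by apply: lt_le_trans sc _; exact: Fc.
  - have sub j x : subcube j x -> cube j x.
      by move=> xj k; have := xj k; have := s0 j; rewrite !mxE; lra.
    by move=> i j x _ _ /sub xi /sub xj; exact: cube_disjoint xi xj.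
move=> j _; rewrite /boxvol (eq_bigr (fun=> s j / 8)) ?prodr_const ?card_ord// => i _.
by have := s0 j => sj; rewrite !mxE max_l; [field|lra].
Qed.

Lemma bumps_le m (j : 'I_N) x : cube j x -> `|bumps m x| <= h j * (s j)^-1 ^+ \sum_k m k.
Proof.
move=> xj; rewrite (bumps_cube _ _ _ xj) normrM (ger0_norm (ltW (h0 j))).
by apply: ler_wpM2l; [exact: ltW|exact: bump_bound].
Qed.

Lemma sum_m0 : (\sum_k m0 k = 0)%N. Proof. by rewrite big1. Qed.

Lemma lebo_bumps_le (sigma : R) : 0 <= sigma ->
  (lebo [set x | (sigma < `|bumps m0 x|)%R]
    <= (\sum_(j | sigma < h j) s j ^+ n.+1)%:E)%E.
Proof.
move=> sg0; apply: lebo_cubes_le => // [j x xj|x]; last exact: bumps_out.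
by have := bumps_le m0 j x xj; rewrite sum_m0 expr0 mulr1.
Qed.

(** Every second derivative is at most [h j / s j ^+ 2] on the [j]-th cube, and [n.+1 ^ 2] bounds
    the number of index pairs. *)
Lemma lebo_hessn_le (sigma : R) : 0 <= sigma ->
  (lebo [set x | (sigma < `|hessn (fun i j => bumps (incr (incr m0 i) j)) x|)%R]
    <= (\sum_(j | (sigma < n.+1%:R ^+ 2 * (h j / s j ^+ 2))%R) s j ^+ n.+1)%:E)%E.
Proof.
move=> sg0; apply: (lebo_cubes_le _ (fun j => n.+1%:R ^+ 2 * (h j / s j ^+ 2))) => //.
  move=> j x xj; rewrite ger0_norm; last first.
    by apply: sumr_ge0 => i _; apply: sumr_ge0 => k _; exact: normr_ge0.
  have hs0 : 0 <= h j / s j ^+ 2 by rewrite divr_ge0// ?exprn_ge0// ltW.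
  apply: (@le_trans _ _ (\sum_(i < n.+1) \sum_(k < n.+1) h j / s j ^+ 2)).
    apply: ler_sum => i _; rewrite [leLHS]big_mkcond; apply: ler_sum => k _.
    case: ifP => // _.
    have := bumps_le (incr (incr m0 i) k) j x xj.
    by rewrite !sum_incr sum_m0 exprVn.
  rewrite big_const_ord iter_addr_0 big_const_ord iter_addr_0.
  by rewrite -mulrnA -[leLHS]mulr_natl natrM -expr2.
move=> x xj; rewrite /hessn big1// => i _; rewrite big1// => k _.
by rewrite bumps_out// normr0.
Qed.

(** The partial derivative in direction [ord0] suffices. On a subcube it is a product of one value
    of the profile's derivative and [n] values of the profile, all at least [c], with one factor
    [s^-1]. *)
Lemma lebo_gradn_ge (c sigma : R) : profile_lower_bound c ->
  ((\sum_(j | (sigma < c ^+ n.+1 * (h j / s j))%R) (s j / 8) ^+ n.+1)%:E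
    <= lebo [set x | (sigma < `|gradn (fun i => bumps (incr m0 i)) x|)%R])%E.
Proof.
move=> cP; apply: (lebo_subcubes_ge _ (fun j => c ^+ n.+1 * (h j / s j))) => j x xj.
apply: le_trans (ler_norm _); rewrite /gradn big_ord_recl.
rewrite -[leLHS]addr0; apply: lerD; last first.
  by apply: sumr_ge0 => i _; exact: normr_ge0.
have cxj : cube j x.
  by move=> k; have := xj k; have := s0 j; rewrite !mxE; lra.
apply: le_trans (ler_norm _); rewrite (bumps_cube _ _ _ cxj) mulrCA.
apply: ler_wpM2l; first exact: ltW.
have := @bump_lower c (incr m0 ord0) j%:R (s j) x cP (s0 j).
rewrite sum_incr sum_m0 expr1; apply; first by move=> k; rewrite /incr; case: eqP.
by move=> k; have := xj k; rewrite !mxE.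
Qed.

End bump_sums.

(** * Decreasing rearrangements *)

Section decreasing_rearrangement.
Context {R : realType}.
Implicit Types (D : R -> \bar R) (H F : R -> R) (s t : R).

Definition distr H s : \bar R := lebR [set x | Ipos x /\ s < `|H x|].

(** Stated for an arbitrary distribution function [D], so that it covers both [ustar] of a function
    on R^d and the rearrangement of a function on the half-line. *)
Definition star D t : \bar R :=
  ereal_inf [set s%:E | s in [set s : R | 0 <= s /\ (D s <= t%:E)%E]].

Lemma star_ge0 D t : (0 <= star D t)%E.
Proof. by apply: le_ereal_inf_tmp => _ [s [s0 _] <-]; rewrite lee_fin. Qed.

Lemma le_star D D' t : (forall s, 0 <= s -> (D s <= D' s)%E) ->
  (star D t <= star D' t)%E.
Proof.
move=> DD'; apply: le_ereal_inf => _ [s [s0 Ds] <-]; exists s => //; split => //.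
exact: le_trans (DD' _ s0) Ds.
Qed.

Lemma star_nonincreasing D t t' : t <= t' -> (star D t' <= star D t)%E.
Proof.
move=> tt'; apply: le_ereal_inf => _ [s [s0 Ds] <-]; exists s => //; split => //.
by apply: le_trans Ds _; rewrite lee_fin.
Qed.

Lemma star_le D M t : 0 <= M -> 0 <= t -> (D M <= 0)%E -> (star D t <= M%:E)%E.
Proof.
move=> M0 t0 DM; apply: ereal_inf_lbound; exists M => //; split => //.
by apply: le_trans DM _; rewrite lee_fin.
Qed.

Lemma mfun0_nonincreasing (f : R -> R) :
  (forall x y, 0 < x -> x <= y -> f y <= f x) -> mfun0 f.
Proof.
move=> fni mI; apply: (measurability (@RGenCInfty.G R)) mI => [|/= _ [_ [r ->]] <-].
  exact: RGenCInfty.measurableE.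
apply: is_interval_measurable => x y [Ix fx] [Iy fy] z /andP[xz zy].
move: Ix fx Iy fy; rewrite /Ipos /= !in_itv/= !andbT => x0 fx y0 fy.
have z0 : 0 < z by exact: lt_le_trans x0 xz.
by split => //; rewrite (le_trans fy)// fni.
Qed.

Lemma mfun0_star D : (forall t, 0 < t -> (star D t < +oo)%E) ->
  mfun0 (fun t => fine (star D t)).
Proof.
move=> Dfin; apply: mfun0_nonincreasing => x y x0 xy.
apply: fine_le; rewrite ?ge0_fin_numE ?star_ge0 ?Dfin//.
  exact: lt_le_trans x0 xy.
exact: star_nonincreasing.
Qed.

Lemma measurable_Ipos : measurable (@Ipos R).
Proof. exact: measurable_itv. Qed.

Lemma measurable_superlevel H s : mfun0 H ->
  measurable [set x | Ipos x /\ s < `|H x|].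
Proof.
move=> mH; rewrite (_ : [set x | _] = @Ipos R `&` (fun x => `|H x|) @^-1` `]s, +oo[%classic).
  have mnH : measurable_fun (@Ipos R) (fun x => `|H x|).
    by apply: measurableT_comp => //; exact: normr_measurable.
  exact: (mnH measurable_Ipos).
by apply/seteqP; split => x /=; rewrite in_itv/= andbT.
Qed.

Lemma distr_nonincreasing H s s' : mfun0 H -> s <= s' -> (distr H s' <= distr H s)%E.
Proof.
move=> mH ss'; apply: le_measure; rewrite ?inE; try exact: measurable_superlevel.
by move=> x [Ix sx]; split => //; exact: le_lt_trans sx.
Qed.

(** Continuity of measure from below along the levels [s + 1/(k+1)]. *)
Lemma distr_right_continuous H s t : mfun0 H -> (t%:E < distr H s)%E ->
  exists2 s', s < s' & (t%:E < distr H s')%E.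
Proof.
move=> mH tD; apply: contrapT => h.
have {}h s' : s < s' -> (distr H s' <= t%:E)%E.
  by move=> ss'; rewrite leNgt; apply/negP => td; apply: h; exists s'.
move: tD; apply/negP; rewrite -leNgt.
pose A k : set R := [set x | Ipos x /\ s + k.+1%:R^-1 < `|H x|].
have cvA : lebR (A k) @[k --> \oo] --> lebR (\bigcup_k A k).
  apply: nondecreasing_cvg_mu.
  - by move=> k; exact: measurable_superlevel.
  - by apply: bigcup_measurable => k _; exact: measurable_superlevel.
  - apply/nondecreasing_seqP => k; apply/subsetPset => x [Ix sx]; split => //.
    by apply: le_lt_trans sx; rewrite lerD2l lef_pV2 ?posrE// ler_nat.
rewrite /distr (_ : [set x | _] = \bigcup_k A k).
  rewrite -(cvg_lim _ cvA)//; apply: lime_le; first by apply/cvg_ex; eexists; exact: cvA.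
  by apply: nearW => k; apply: h; rewrite ltrDl invr_gt0.
apply/seteqP; split => x /=; last first.
  by move=> [k _ [Ix sx]]; split => //; apply: lt_trans sx; rewrite ltrDl invr_gt0.
move=> [Ix sx]; exists (Num.truncn (`|H x| - s)^-1) => //; split => //.
rewrite -ltrBrDl invf_plt ?posrE ?subr_gt0//; exact: truncnS_gt.
Qed.

(** The rearrangement is the generalized inverse of the distribution function. Right continuity is
    what gives the strict inequality from right to left. *)
Lemma lt_star H s t : mfun0 H -> 0 <= s -> (s%:E < star (distr H) t)%E = (t%:E < distr H s)%E.
Proof.
move=> mH s0; apply/idP/idP => [|/(distr_right_continuous _ _ _ mH)[s' ss' ts']].
  rewrite ltNge; apply: contraNT; rewrite -leNgt => Dt.
  by apply: ereal_inf_lbound; exists s.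
apply: (@lt_le_trans _ _ s'%:E); first by rewrite lte_fin.
apply: le_ereal_inf_tmp => _ [r [r0 Dr] <-]; rewrite lee_fin leNgt.
apply/negP => rs'; move: ts'; apply/negP; rewrite -leNgt; apply: le_trans Dr.
exact: distr_nonincreasing (ltW rs').
Qed.

Lemma lebR_below (d : \bar R) : (0 <= d)%E -> lebR [set t | Ipos t /\ (t%:E < d)%E] = d.
Proof.
case: d => [r|_|//].
  rewrite lee_fin => r0; rewrite (_ : [set t | _] = `]0, r[%classic).
    rewrite /lebR lebesgue_measure_itv/= lte_fin; have [_|r0'] := ltP.
      by rewrite oppr0 adde0.
    by congr EFin; apply/eqP; rewrite eq_le r0 r0'.
  apply/seteqP; split => t; rewrite /Ipos/= !in_itv/= andbT lte_fin; first by move=> [-> ->].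
  by move/andP.
rewrite (_ : [set t | _] = `]0, +oo[%classic).
  by rewrite /lebR lebesgue_measure_itv/= ltry.
by apply/seteqP; split => [t [//]|t It]; split => //; rewrite ltry.
Qed.

(** By [lt_star] the superlevel set of the rearrangement at height [s] is the interval from 0 to
    [distr H s], whose length is that value. *)
Lemma distr_star H s : mfun0 H -> (forall t, 0 < t -> (star (distr H) t < +oo)%E) ->
  0 <= s -> distr (fun t => fine (star (distr H) t)) s = distr H s.
Proof.
move=> mH fH s0; rewrite -[RHS]lebR_below; last exact: measure_ge0.
have E t : Ipos t -> (s < `|fine (star (distr H) t)|) = (t%:E < distr H s)%E.
  rewrite /Ipos/= in_itv/= andbT => t0.
  rewrite -(lt_star _ _ _ mH s0) ger0_norm ?fine_ge0 ?star_ge0// -lte_fin fineK//.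
  by rewrite ge0_fin_numE ?star_ge0// fH.
by congr lebR; apply/seteqP; split => t [It st]; split => //; [rewrite -E|rewrite E].
Qed.

Variable rho : (R -> R) -> \bar R.
Hypothesis rhoP : RIBFS rho.

Lemma rho_le f g : mfun0 f -> mfun0 g ->
  (forall x, 0 < x -> `|f x| <= `|g x|) -> (rho f <= rho g)%E.
Proof.
move=> mf mg fg; apply: (bfs_ideal rhoP.1) => //; apply: aeW => x.
by rewrite /Ipos/= in_itv/= andbT; exact: fg.
Qed.

(** Finiteness is assumed because [fine] would turn an infinite value of the rearrangement into
    0. *)
Lemma rho_star H : mfun0 H -> (forall t, 0 < t -> (star (distr H) t < +oo)%E) ->
  rho (fun t => fine (star (distr H) t)) = rho H.
Proof.
move=> mH fH; apply: rhoP.2 => //; first exact: mfun0_star.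
by move=> s s0; exact: distr_star.
Qed.

(** An inequality between distribution functions becomes a pointwise one between rearrangements, and
    the ideal property turns it into one between norms. Finiteness is inherited from [H]. *)
Lemma rho_star_le D H : mfun0 H ->
  (forall t, 0 < t -> (star (distr H) t < +oo)%E) ->
  (forall s, 0 <= s -> (D s <= distr H s)%E) ->
  [/\ forall t, 0 < t -> (star D t < +oo)%E, mfun0 (fun t => fine (star D t))
    & (rho (fun t => fine (star D t)) <= rho H)%E].
Proof.
move=> mH fH DH.
have fD t : 0 < t -> (star D t < +oo)%E.
  by move=> /fH; apply: le_lt_trans; exact: le_star.
split => //; first exact: mfun0_star.
rewrite -(rho_star H mH fH); apply: rho_le; [exact: mfun0_star|exact: mfun0_star|move=> t t0].
rewrite !ger0_norm ?fine_ge0 ?star_ge0// fine_le ?ge0_fin_numE ?star_ge0 ?fD ?fH//.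
exact: le_star.
Qed.

Lemma rho_star_ge D F : mfun0 F ->
  (forall t, 0 < t -> (star D t < +oo)%E) ->
  (forall s, 0 <= s -> (distr F s <= D s)%E) ->
  (rho F <= rho (fun t => fine (star D t)))%E.
Proof.
move=> mF fD FD.
have fF t : 0 < t -> (star (distr F) t < +oo)%E.
  by move=> /fD; apply: le_lt_trans; exact: le_star.
rewrite -(rho_star F mF fF); apply: rho_le; [exact: mfun0_star|exact: mfun0_star|move=> t t0].
rewrite !ger0_norm ?fine_ge0 ?star_ge0// fine_le ?ge0_fin_numE ?star_ge0 ?fD ?fF//.
exact: le_star.
Qed.

End decreasing_rearrangement.

(** * Step functions on the half-line *)

Set Implicit Arguments.
Unset Strict Implicit.

Section step_functions.
Context {R : realType}.

Definition stepfun (K : finType) (v : K -> R) (E : K -> set R) (x : R) : R :=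
  \sum_k v k * \1_(E k) x.

Record step_family (K : finType) (E : K -> set R) (w : K -> R) : Prop := {
  step_measurable : forall k, measurable (E k) ;
  step_Ipos : forall k x, E k x -> 0 < x ;
  step_disjoint : forall k l x, E k x -> E l x -> k = l ;
  step_measure : forall k, lebR (E k) = (w k)%:E }.

Section one_family.
Variables (K : finType) (E : K -> set R) (w : K -> R).
Hypothesis Ew : step_family E w.
Implicit Types v : K -> R.

Lemma step_measure_ge0 k : 0 <= w k.
Proof. by rewrite -lee_fin -(step_measure Ew) measure_ge0. Qed.

Lemma stepfun_in v k x : E k x -> stepfun v E x = v k.
Proof.
move=> Ekx; rewrite /stepfun (bigD1 k)//= big1 => [|l lk].
  by rewrite indicE mem_set// mulr1 addr0.
rewrite indicE memNset ?mulr0// => Elx.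
by move/eqP: lk; apply; exact: (step_disjoint Ew) Elx Ekx.
Qed.

Lemma stepfun_out v x : (forall k, ~ E k x) -> stepfun v E x = 0.
Proof.
by move=> nE; rewrite /stepfun big1// => k _; rewrite indicE memNset ?mulr0.
Qed.

Lemma mfun0_stepfun v : mfun0 (stepfun v E).
Proof.
apply: measurable_funTS; apply: measurable_sum => k.
apply: measurable_funM; first exact: measurable_cst.
exact: measurable_indic (step_measurable Ew k).
Qed.

Lemma distr_stepfun v s : 0 <= s ->
  distr (stepfun v E) s = (\sum_(k | s < `|v k|) w k)%:E.
Proof.
move=> s0; rewrite /distr.
pose r := [seq k <- index_enum K | s < `|v k|].
have ur : uniq r by rewrite filter_uniq// index_enum_uniq.
have rE k : k \in r = (s < `|v k|) by rewrite mem_filter mem_index_enum andbT.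
rewrite (_ : [set x | _] = \bigcup_(k in [set` r]) E k).
  rewrite /lebR measure_fin_bigcup.
  - rewrite -fsbig_seq// big_filter -sumEFin; apply: eq_bigr => k _.
    exact: (step_measure Ew).
  - exact: finite_seq.
  - by move=> k l _ _ [x [Ek El]]; exact: (step_disjoint Ew) Ek El.
  - by move=> k _; exact: (step_measurable Ew).
apply/seteqP; split => x /=.
  move=> [_ sx]; have [[k Ekx]|/forallNP nE] := pselect (exists k, E k x).
    by exists k => //=; rewrite rE -(stepfun_in _ Ekx).
  by move: sx; rewrite stepfun_out// normr0 ltNge s0.
move=> [k /=]; rewrite rE => sk Ekx; split.
  by rewrite /Ipos/= in_itv/= andbT (step_Ipos Ew Ekx).
by rewrite (stepfun_in _ Ekx).
Qed.

Lemma star_stepfun_lty v t : 0 < t -> (star (distr (stepfun v E)) t < +oo)%E.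
Proof.
move=> t0; apply: (@le_lt_trans _ _ (\sum_k `|v k|)%:E); last exact: ltry.
have v0 : 0 <= \sum_k `|v k| by apply: sumr_ge0.
apply: star_le => //; first exact: ltW.
rewrite distr_stepfun// big_pred0// => k; apply/negbTE; rewrite -leNgt.
by rewrite (bigD1 k)//= lerDl sumr_ge0.
Qed.

End one_family.

Lemma step_family_exists (K : finType) (w : K -> R) : (forall k, 0 <= w k) ->
  exists E, step_family E w.
Proof.
(* A spacing at least as large as each [w k] keeps the intervals disjoint; the summand 1 makes it
   positive even if all weights vanish. *)
move=> w0; pose T : R := 1 + \sum_k w k.
pose lo (k : K) : R := T * (enum_rank k)%:R.
have wT k : w k <= T.
  rewrite /T (bigD1 k)//= addrCA lerDl addr_ge0// ?sumr_ge0//.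
have T0 : 0 < T by rewrite /T ltr_wpDr// sumr_ge0.
exists (fun k => `]lo k, (lo k + w k)]%classic); split.
- by move=> k; exact: measurable_itv.
- move=> k x; rewrite /= in_itv/= => /andP[+ _]; apply: le_lt_trans.
  by rewrite mulr_ge0// ltW.
- move=> k l x; rewrite /= !in_itv/= => /andP[k1 k2] /andP[l1 l2].
  apply/enum_rank_inj/val_inj/eqP; rewrite eqn_leq.
  have lt_rank (i j : K) : lo i < x -> x <= lo j + w j -> (enum_rank i <= enum_rank j)%N.
    move=> ix xj; rewrite -ltnS -(ltr_nat R) -(ltr_pM2l T0).
    rewrite -natr1 mulrDr mulr1 -!/(lo _).
    by apply: (lt_le_trans ix); apply: (le_trans xj); rewrite lerD2l.
  by apply/andP; split; apply: lt_rank.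
- move=> k; rewrite /lebR lebesgue_measure_itv/= lte_fin.
  case: ifPn => [_|]; first by rewrite -EFinB addrC addKr.
  rewrite -leNgt gerDl => wk; congr EFin; apply/eqP.
  by rewrite eq_le wk w0.
Qed.

Variable rho : (R -> R) -> \bar R.
Hypothesis rhoP : RIBFS rho.

Lemma rho0 : rho (cst 0) = 0%E.
Proof.
by apply/(bfs_eq0 rhoP.1); [exact: measurable_cst|apply: aeW].
Qed.

Lemma rho_sum (I : Type) (r : seq I) (f : I -> R -> R) :
  (forall i, mfun0 (f i)) ->
  (rho (fun x => (\sum_(i <- r) f i x)%R) <= \sum_(i <- r) rho (f i))%E.
Proof.
move=> mf; elim: r => [|i r IH].
  by under eq_fun do rewrite big_nil; rewrite big_nil rho0.
under eq_fun do rewrite big_cons; rewrite big_cons.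
apply: le_trans (bfs_triangle rhoP.1 (mf i) _) _; last exact: leeD2l.
exact: measurable_sum.
Qed.

Lemma rho_stepfun_eq (K K' : finType) (E : K -> set R) (E' : K' -> set R) w w'
    (v : K -> R) (v' : K' -> R) : step_family E w -> step_family E' w' ->
  (forall s, \sum_(k | s < `|v k|) w k = \sum_(k | s < `|v' k|) w' k) ->
  rho (stepfun v E) = rho (stepfun v' E').
Proof.
move=> Ew Ew' h; apply: (rhoP.2 _ _ (mfun0_stepfun Ew v) (mfun0_stepfun Ew' v')).
move=> s s0; have := h s.
by rewrite -!/(distr _ _) (distr_stepfun Ew)// (distr_stepfun Ew')// => ->.
Qed.

(* Cutting every level set into [N] pieces of equal measure writes [stepfun v E]
   as a sum of [N] functions equimeasurable with [stepfun v E']. *)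
Lemma rho_stepfun_dilate (K : finType) (E E' : K -> set R) w (v : K -> R) (N : nat) :
  (0 < N)%N -> step_family E w -> step_family E' (fun k => w k / N%:R) ->
  (rho (stepfun v E) <= N%:R%:E * rho (stepfun v E'))%E.
Proof.
move=> N0 Ew Ew'.
have [J Jw] := @step_family_exists (K * 'I_N)%type (fun kl => w kl.1 / N%:R)
  (fun kl => step_measure_ge0 Ew' kl.1).
have Jl l : step_family (fun k => J (k, l)) (fun k => w k / N%:R).
  split.
  - by move=> k; exact: (step_measurable Jw).
  - by move=> k x; exact: (step_Ipos Jw).
  - by move=> k k' x Jk Jk'; have [] := step_disjoint Jw Jk Jk'.
  - by move=> k; exact: (step_measure Jw).
rewrite (@rho_stepfun_eq _ _ _ _ _ _ v (fun kl => v kl.1) Ew Jw); last first.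
  move=> s.
  rewrite [RHS](_ : _ = \sum_(k | s < `|v k|) \sum_(l < N) w k / N%:R); last first.
    by rewrite pair_big_dep/=; apply: eq_bigl => -[k l]/=; rewrite andbT.
  apply: eq_bigr => k _.
  rewrite big_const_ord iter_addr_0 -[RHS]mulr_natr mulfVK// pnatr_eq0.
  by rewrite -lt0n.
rewrite (_ : stepfun _ J = fun x => \sum_(l < N) stepfun v (fun k => J (k, l)) x).
  apply: le_trans (rho_sum _ _) _; first by move=> l; exact: (mfun0_stepfun (Jl l) v).
  rewrite (eq_bigr (fun=> rho (stepfun v E'))); last first.
    by move=> l _; apply: rho_stepfun_eq (Jl l) Ew' _.
  rewrite mule_natl big_const_ord; move: (rho _) => r; rewrite le_eqVlt.
  apply/orP; left; apply/eqP; elim: (N) => // k IH; rewrite iterS IH. by rewrite muleS.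
apply/funext => x; rewrite /stepfun exchange_big/=.
by rewrite pair_bigA/=; apply: eq_bigr => -[].
Qed.

End step_functions.

(** * The interpolation inequality for step functions *)

Section gagliardo_nirenberg_step.
Context {R : realType} {n : nat}.
Local Notation V := 'rV[R]_n.+1.

(** A minimum over finitely many constraints. The side [e * r k] is at most 1 for disjointness, and
    at most [w k] so that a set of positive measure receives at least one cube. *)
Lemma small_scale (K : finType) (r w : K -> R) : (forall k, 0 < r k) ->
  exists2 e : R, 0 < e & forall k, e * r k <= 1 /\ (0 < w k -> e * r k <= w k).
Proof.
move=> r0; pose f k := Num.min 1 (if 0 < w k then w k else 1) / r k.
have f0 k : 0 < f k by rewrite divr_gt0// lt_min ltr01/=; case: ifP.
exists (\big[Num.min/1]_k f k); first by apply/bigmin_gtP; split.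
move=> k; have ek : \big[Num.min/1]_k f k * r k <= Num.min 1 (if 0 < w k then w k else 1).
  by rewrite -ler_pdivlMr//; exact: bigmin_le.
split=> [|wk]; first by rewrite (le_trans ek)// ge_min lexx.
by move: ek; rewrite wk => /le_trans; apply; rewrite ge_min lexx orbT.
Qed.

Lemma cube_count (s w : R) : 0 < s -> s <= 1 -> 0 <= w -> (0 < w -> s <= w) ->
  let c := Num.truncn (w / s ^+ n.+1) in
  c%:R * s ^+ n.+1 <= w /\ w / 2 <= c%:R * s ^+ n.+1.
Proof.
move=> s0 s1 w0 sw c; have sn0 : 0 < s ^+ n.+1 by rewrite exprn_gt0.
have q0 : 0 <= w / s ^+ n.+1 by rewrite divr_ge0// ltW.
have /andP[cq qc] := truncn_itv q0.
split; first by rewrite -ler_pdivlMr.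
move: w0 sw; rewrite le_eqVlt => /predU1P[<- _|wp /(_ wp) sw].
  by rewrite mul0r mulr_ge0// ltW.
(* Rounding down a number that is at least 1 loses at most half of it. *)
have q1 : 1 <= w / s ^+ n.+1.
  rewrite ler_pdivlMr// mul1r (le_trans _ sw)// exprS.
  by apply: ler_piMr; [exact: ltW|apply: exprn_ile1 => //; exact: ltW].
have c1 : 1 <= c%:R :> R by rewrite ler1n /c truncn_gt0.
have : w < (c%:R + 1) * s ^+ n.+1 by rewrite -ltr_pdivrMr// natr1.
have : 0 <= (c%:R - 1) * s ^+ n.+1 by rewrite mulr_ge0 ?subr_ge0// ltW.
by lra.
Qed.

(** [J] has one element for each cube, tagged by the step it stands for. Its enumeration by ordinals
    supplies the integer positions of the cubes. *)
Lemma sum_over_copies (K : finType) (c : K -> nat) (P : pred K) (F : K -> R) :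
  let J : finType := {k : K & 'I_(c k)} in
  \sum_(j < #|J| | P (tag (enum_val j))) F (tag (enum_val j)) =
  \sum_(k | P k) (c k)%:R * F k.
Proof.
move=> J.
rewrite -(big_enum_val_cond (A := J) (fun x : J => P (tag x)) (fun x : J => F (tag x))).
transitivity (\sum_(k | P k) \sum_(i < c k) F k).
  rewrite (sig_big_dep (fun k => P k) (fun k (i : 'I_(c k)) => true)
    (fun k (i : 'I_(c k)) => F k)).
  by apply: eq_bigl => x; rewrite andbT inE.
by apply: eq_bigr => k _; rewrite big_const_ord iter_addr_0 mulr_natl.
Qed.

End gagliardo_nirenberg_step.

Section interpolation_for_step_functions.
Context {R : realType} {n : nat}.
Local Notation V := 'rV[R]_n.+1.
Variables (rhoY rhoZ rhoB : (R -> R) -> \bar R) (C c0 : R).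
Hypotheses (rY : RIBFS rhoY) (rZ : RIBFS rhoZ) (rB : RIBFS rhoB).
Hypotheses (C0 : 0 < C) (c0P : profile_lower_bound c0).
Hypothesis interpolation : forall (u : V -> R) Du D2u,
  W21loc u Du D2u -> memd rhoZ u ->
  (nrmd rhoB (gradn Du) <=
    C%:E * poweR (nrmd rhoY (hessn D2u)) 2^-1 * poweR (nrmd rhoZ u) 2^-1)%E.

Lemma rho_stepfun_scale (rho : (R -> R) -> \bar R) (K : finType) (E : K -> set R) w
    (v : K -> R) (k : R) : RIBFS rho -> step_family E w -> 0 <= k ->
  rho (stepfun (fun i => k * v i) E) = (k%:E * rho (stepfun v E))%E.
Proof.
move=> rhoP Ew k0; rewrite -[in RHS](ger0_norm k0).
rewrite -(bfs_scale rhoP.1 k (mfun0_stepfun Ew v)); congr rho.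
by apply/funext => x; rewrite /stepfun mulr_sumr; under eq_bigr do rewrite -mulrA.
Qed.

Lemma poweR_half_le (x : \bar R) (y : R) : (0 <= x)%E -> 0 <= y -> (x <= y%:E)%E ->
  (poweR x 2^-1 <= (Num.sqrt y)%:E)%E.
Proof.
move=> x0 y0 xy; rewrite -powR12_sqrt// -poweR_EFin.
apply: gt0_ler_poweR => //.
- by rewrite in_itv/= x0 leey.
- by rewrite in_itv/= lee_fin y0 leey.
Qed.

(** The cubes fill at least half of [w k], and a subcube has the fraction [8 ^ -(n+1)] of the volume
    of its cube. *)
Definition pieces : nat := (2 * 8 ^ n.+1)%N.

(** [n.+1] is the square root of the Hessian factor, [c0 ^+ n.+1] comes from the lower bound of the
    gradient, and [pieces] from the dilation. *)
Definition step_const : R := pieces%:R * (n.+1%:R * C / c0 ^+ n.+1).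

Lemma rho_stepfun_interpolation (K : finType) (E : K -> set R) (w a b : K -> R) (y z : R) :
  step_family E w -> (forall k, 0 < a k) -> (forall k, 0 < b k) ->
  0 <= y -> 0 <= z ->
  (rhoY (stepfun a E) <= y%:E)%E -> (rhoZ (stepfun b E) <= z%:E)%E ->
  (rhoB (stepfun (fun k => Num.sqrt (a k) * Num.sqrt (b k))%R E) <=
    (step_const * Num.sqrt y * Num.sqrt z)%:E)%E.
Proof.
move=> Ew a0 b0 y0 z0 Yy Zz.
have w0 := step_measure_ge0 Ew.
pose r k := Num.sqrt (b k) / Num.sqrt (a k).
have sa k : 0 < Num.sqrt (a k) by rewrite sqrtr_gt0.
have sb k : 0 < Num.sqrt (b k) by rewrite sqrtr_gt0.
have saE k : Num.sqrt (a k) ^+ 2 = a k by rewrite sqr_sqrtr// ltW.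
have sbE k : Num.sqrt (b k) ^+ 2 = b k by rewrite sqr_sqrtr// ltW.
have r0 k : 0 < r k by rewrite divr_gt0.
have [e e0 er] := small_scale w r0.
pose s k := e * r k.
have s0 k : 0 < s k by rewrite mulr_gt0.
have s1 k : s k <= 1 := (er k).1.
pose c k := Num.truncn (w k / s k ^+ n.+1).
have cw k : (c k)%:R * s k ^+ n.+1 <= w k /\ w k / 2 <= (c k)%:R * s k ^+ n.+1.
  exact: (cube_count (s0 k) (s1 k) (w0 k) (er k).2).
pose J : finType := {k : K & 'I_(c k)}.
pose kap (j : 'I_#|J|) : K := tag (enum_val j).
pose hh j := b (kap j); pose ss j := s (kap j).
have hh0 j : 0 < hh j by exact: b0.
have ss0 j : 0 < ss j by exact: s0.
have ss1 j : ss j <= 1 by exact: s1.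
have W := @W21loc_bumps R n #|J| hh ss ss0 ss1.
set u := (X in W21loc X _ _) in W; set Du := (X in W21loc _ X _) in W.
set D2u := (X in W21loc _ _ X) in W.
pose cube_sum := @sum_over_copies R K c.
have upper (P : pred K) :
    (\sum_(j | P (kap j)) ss j ^+ n.+1 <= \sum_(k | P k) w k)%R.
  rewrite (cube_sum P (fun k => s k ^+ n.+1)); apply: ler_sum => k _.
  exact: (cw k).1.
have [uoo mfu Zu] : [/\ forall t, 0 < t -> (ustar u t < +oo)%E,
    mfun0 (fun t => fine (ustar u t)) & (rhoZ (fun t => fine (ustar u t)) <= z%:E)%E].
  have [|A1 A2 A3] := rho_star_le _ rZ (fun sg => lebo [set x | (sg < `|u x|)%R])
    _ (mfun0_stepfun Ew b) (@star_stepfun_lty _ _ _ _ Ew b).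
    move=> sg sg0; rewrite (distr_stepfun Ew)//.
    apply: le_trans (lebo_bumps_le _ _ _ hh0 ss0 ss1 sg sg0) _; rewrite lee_fin.
    under [leRHS]eq_bigl do rewrite ger0_norm ?ltW//.
    exact: (upper (fun k => sg < b k)).
  by split => //; apply: le_trans A3 Zz.
(* With [s k = e * sqrt (b k / a k)] the Hessian is at most [kp * a k] on the cubes of index [k]. *)
pose kp : R := n.+1%:R ^+ 2 / e ^+ 2.
have kp0 : 0 <= kp by rewrite divr_ge0// exprn_ge0// ltW.
have hE k : n.+1%:R ^+ 2 * (b k / s k ^+ 2) = kp * a k.
  rewrite /s /r /kp; move: (sa k) (sb k) (saE k) (sbE k).
  move: (Num.sqrt (a k)) (Num.sqrt (b k)) => A B A0 B0 <- <-.
  by field; rewrite !gt_eqF.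
have [hoo _ Yh] : [/\ forall t, 0 < t -> (ustar (hessn D2u) t < +oo)%E,
    mfun0 (fun t => fine (ustar (hessn D2u) t))
    & (rhoY (fun t => fine (ustar (hessn D2u) t)) <= (kp * y)%:E)%E].
  have [|A1 A2 A3] := rho_star_le _ rY
    (fun sg => lebo [set x | (sg < `|hessn D2u x|)%R])
    _ (mfun0_stepfun Ew (fun k => kp * a k))
    (@star_stepfun_lty _ _ _ _ Ew (fun k => kp * a k)).
    move=> sg sg0; rewrite (distr_stepfun Ew)//.
    apply: le_trans (lebo_hessn_le _ _ _ hh0 ss0 ss1 sg sg0) _; rewrite lee_fin.
    rewrite [leRHS](eq_bigl (fun k => sg < n.+1%:R ^+ 2 * (b k / s k ^+ 2))).
      exact: (upper (fun k => sg < n.+1%:R ^+ 2 * (b k / s k ^+ 2))).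
    by move=> k; rewrite hE ger0_norm// mulr_ge0// ltW.
  split => //; apply: le_trans A3 _; rewrite (rho_stepfun_scale _ rY Ew kp0).
  by rewrite [leRHS]EFinM; apply: lee_wpmul2l; rewrite ?lee_fin.
have nYh : (nrmd rhoY (hessn D2u) <= (kp * y)%:E)%E.
  by rewrite /nrmd asboolT.
have nZu : (nrmd rhoZ u <= z%:E)%E by rewrite /nrmd asboolT.
have rho_ge0 (rho : (R -> R) -> \bar R) f : RIBFS rho -> (0 <= rho f)%E.
  by move=> [rhoP _]; exact: bfs_ge0.
have nrmd_ge0 (rho : (R -> R) -> \bar R) (f : V -> R) : RIBFS rho -> (0 <= nrmd rho f)%E.
  by move=> rhoP; rewrite /nrmd; case: ifP => _; rewrite ?rho_ge0// leey.
have memu : memd rhoZ u by split => //; split => //; apply: le_lt_trans Zu _; rewrite ltry.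
have nBu : (nrmd rhoB (gradn Du) <=
    (C * (n.+1%:R / e * Num.sqrt y) * Num.sqrt z)%:E)%E.
  apply: le_trans (interpolation W memu) _.
  rewrite [leRHS](_ : _ = C%:E * (n.+1%:R / e * Num.sqrt y)%R%:E * (Num.sqrt z)%:E)%E;
    last by rewrite -!EFinM.
  have -> : n.+1%:R / e * Num.sqrt y = Num.sqrt (kp * y).
    by rewrite sqrtrM// /kp -expr_div_n sqrtr_sqr ger0_norm// divr_ge0// ltW.
  apply: lee_pmul; rewrite ?mule_ge0 ?poweR_ge0 ?lee_fin ?(ltW C0)//.
    apply: lee_pmul; rewrite ?poweR_ge0 ?lee_fin ?(ltW C0)//.
    by apply: poweR_half_le; rewrite ?nrmd_ge0// mulr_ge0.
  by apply: poweR_half_le; rewrite ?nrmd_ge0.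
(* The interpolation inequality itself gives finiteness, as [nrmd] would otherwise be infinite by
   definition. *)
have goo : forall t, 0 < t -> (ustar (gradn Du) t < +oo)%E.
  by apply: contrapT => ng; move: nBu; rewrite /nrmd asboolF// leye_eq.
have piece0 : 0 < pieces%:R :> R by rewrite ltr0n /pieces muln_gt0 expn_gt0.
(* The sets [E'] have the part of the measure that the subcubes are sure to fill;
   [rho_stepfun_dilate] later returns from [E'] to [E]. *)
have [E' Ew'] := step_family_exists (fun k => divr_ge0 (w0 k) (ltW piece0)).
pose f k := Num.sqrt (a k) * Num.sqrt (b k).
have f0 k : 0 < f k by rewrite mulr_gt0.
have c00 := c0P.1.
(* The gradient is at least [q * f k] on the subcubes of index [k]. The factor [1 / e] in [q]
   cancels the one in [nBu]. *)
pose q : R := c0 ^+ n.+1 / e.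
have q0 : 0 < q by rewrite divr_gt0// exprn_gt0.
have gE k : c0 ^+ n.+1 * (b k / s k) = q * f k.
  rewrite /s /r /f /q; move: (sa k) (sb k) (sbE k).
  move: (Num.sqrt (a k)) (Num.sqrt (b k)) => A B A0 B0 <-.
  by field; rewrite !gt_eqF.
have Bf : (rhoB (stepfun (fun k => (q * f k)%R) E') <= nrmd rhoB (gradn Du))%E.
  rewrite /nrmd asboolT//.
  apply: (rho_star_ge _ rB (fun sg => lebo [set x | (sg < `|gradn Du x|)%R])
    _ (mfun0_stepfun Ew' (fun k => q * f k)) goo) => sg sg0.
  rewrite (distr_stepfun Ew')//.
  apply: le_trans (lebo_gradn_ge _ _ _ hh0 ss0 ss1 _ sg c0P); rewrite lee_fin.
  have := cube_sum (fun k => sg < c0 ^+ n.+1 * (b k / s k)) (fun k => (s k / 8) ^+ n.+1).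
  move=> /= ->.
  rewrite [leLHS](eq_bigl (fun k => sg < c0 ^+ n.+1 * (b k / s k))); last first.
    by move=> k; rewrite gE ger0_norm// mulr_ge0// ltW.
  apply: ler_sum => k _; rewrite expr_div_n mulrA ler_pdivlMr ?exprn_gt0//.
  apply: le_trans (cw k).2; rewrite /pieces natrM natrX.
  by rewrite invfM mulrA divfK ?expf_neq0// pnatr_eq0.
apply: (le_trans (rho_stepfun_dilate rB f _ Ew Ew')).
  by rewrite /pieces muln_gt0 expn_gt0.
move: (le_trans Bf nBu); rewrite (rho_stepfun_scale _ rB Ew' (ltW q0)) => H.
have {}H : (rhoB (stepfun f E') <= (q^-1 * (C * (n.+1%:R / e * Num.sqrt y) * Num.sqrt z))%:E)%E.
  by rewrite [leRHS]EFinM lee_pdivlMl.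
apply: (@le_trans _ _ (pieces%:R%:E * (q^-1 * (C * (n.+1%:R / e * Num.sqrt y) * Num.sqrt z))%:E)%E).
  by apply: lee_pmul => //; exact: rho_ge0.
rewrite -EFinM lee_fin le_eqVlt; apply/orP; left; apply/eqP.
rewrite /step_const /q; field.
by rewrite !gt_eqF ?exprn_gt0.
Qed.

End interpolation_for_step_functions.

(** * Passage to the limit *)

Import HBNNSimple.

Section interpolation.
Context {R : realType} {n : nat}.
Local Notation V := 'rV[R]_n.+1.
Variables (rhoY rhoZ rhoB : (R -> R) -> \bar R) (C : R).
Hypotheses (rY : RIBFS rhoY) (rZ : RIBFS rhoZ) (rB : RIBFS rhoB) (C0 : 0 < C).
Hypothesis interpolation : forall (u : V -> R) Du D2u,
  W21loc u Du D2u -> memd rhoZ u ->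
  (nrmd rhoB (gradn Du) <=
    C%:E * poweR (nrmd rhoY (hessn D2u)) 2^-1 * poweR (nrmd rhoZ u) 2^-1)%E.

Lemma rho_simple_interpolation (c0 : R) (ga ha : {nnsfun R >-> R}) (g h : R -> R)
    (N : nat) (y z : R) : profile_lower_bound c0 ->
  mfun0 g -> mfun0 h -> (forall x, 0 < x -> ga x <= g x) -> (forall x, 0 < x -> ha x <= h x) ->
  0 <= y -> 0 <= z -> (rhoY g <= y%:E)%E -> (rhoZ h <= z%:E)%E ->
  let f x := Num.sqrt (ga x) * Num.sqrt (ha x) * \1_(`]0, N%:R]%classic) x in
  mfun0 f /\ (rhoB f <= (step_const (n := n) C c0 * Num.sqrt y * Num.sqrt z)%:E)%E.
Proof.
move=> c0P mg mh gag hah y0 z0 Yg Zh f.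
have /finite_seqP[A Aga] := @fimfunP _ _ ga.
have /finite_seqP[B Bha] := @fimfunP _ _ ha.
pose K : finType := (seq_sub A * seq_sub B)%type.
(* Steps are indexed by pairs of values, and only pairs of positive values count: elsewhere the
   product of square roots is 0. Other pairs get the empty set and the dummy value 1, since [a] and
   [b] must be positive. *)
pose good (k : K) := (0 < val k.1) && (0 < val k.2).
pose a (k : K) : R := if good k then val k.1 else 1.
pose b (k : K) : R := if good k then val k.2 else 1.
pose E (k : K) : set R := if good k then
  `]0, N%:R] `&` (ga @^-1` [set val k.1] `&` ha @^-1` [set val k.2]) else set0.
have a0 k : 0 < a k by rewrite /a; case: ifP => // /andP[].
have b0 k : 0 < b k by rewrite /b; case: ifP => // /andP[].
have mE k : measurable (E k).
  rewrite /E; case: ifP => // _; apply: measurableI; first exact: measurable_itv.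
  by apply: measurableI; exact: measurable_funPTI.
have EP k x : E k x -> [/\ good k, 0 < x, x <= N%:R, ga x = a k & ha x = b k].
  rewrite /E /a /b; case: ifP => // gk [+ [gax hax]].
  by rewrite /= in_itv/= => /andP[].
(* The cutoff at [N] is what makes the level sets have finite measure. *)
have Efin k : lebR (E k) \is a fin_num.
  rewrite ge0_fin_numE ?measure_ge0//.
  apply: (@le_lt_trans _ _ (lebR `]0%R, N%:R]%classic)).
    apply: le_measure; rewrite ?inE; [exact: mE|exact: measurable_itv|].
    by move=> x /EP[_ x0 xN _ _]; rewrite /= in_itv/= x0.
  by rewrite /lebR lebesgue_measure_itv/=; case: ifP => _; rewrite ?ltry// -EFinB ltry.
have Ew : step_family E (fun k => fine (lebR (E k))).
  split => //.
  - by move=> k x /EP[].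
  - move=> k l x /EP[gk _ _ ak bk] /EP[gl _ _ al bl].
    move: ak bk al bl; rewrite /a /b gk gl => -> -> e1 e2.
    case: k l {gk gl} e1 e2 => [k1 k2] [l1 l2] /= e1 e2.
    by congr pair; apply: val_inj.
  - by move=> k; rewrite fineK.
have Ex x : 0 < x -> x <= N%:R -> 0 < ga x -> 0 < ha x -> exists k, E k x.
  move=> x0 xN gx hx.
  have gA : [set` A] (ga x) by rewrite -Aga; exists x.
  have hB : [set` B] (ha x) by rewrite -Bha; exists x.
  exists (SeqSub gA, SeqSub hB); rewrite /E /good/= gx hx/=.
  by split => //=; rewrite in_itv/= x0.
have fE : f = stepfun (fun k => Num.sqrt (a k) * Num.sqrt (b k)) E.
  apply/funext => x; have [[k Ekx]|/forallNP nE] := pselect (exists k, E k x).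
    rewrite (stepfun_in Ew _ Ekx) /f; have [_ x0 xN -> ->] := EP _ _ Ekx.
    by rewrite indicE mem_set ?mulr1//= in_itv/= x0.
  rewrite stepfun_out// /f indicE.
  have [|] := boolP (x \in _); last by rewrite mulr0.
  rewrite inE/= in_itv/= => /andP[x0 xN]; rewrite mulr1.
  have [gx|gx] := ltP 0 (ga x); last by rewrite ler0_sqrtr// mul0r.
  have [hx|hx] := ltP 0 (ha x); last by rewrite [X in _ * X]ler0_sqrtr// mulr0.
  by have [k /nE] := Ex x x0 xN gx hx.
split; first by rewrite fE; exact: (mfun0_stepfun Ew).
have dom (rho : (R -> R) -> \bar R) (v : K -> R) (p q : R -> R) : RIBFS rho ->
    mfun0 q -> (forall x, 0 <= p x) -> (forall x, 0 < x -> p x <= q x) ->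
    (forall k x, E k x -> p x = v k) -> (rho (stepfun v E) <= rho q)%E.
  move=> rhoP mq p0 pq pv; apply: rho_le => //; first exact: mfun0_stepfun Ew v.
  move=> x x0; apply: le_trans (ler_norm _).
  have [[k Ekx]|/forallNP nE] := pselect (exists k, E k x).
    by rewrite (stepfun_in Ew _ Ekx) -(pv _ _ Ekx) ger0_norm// pq.
  by rewrite stepfun_out// normr0 (le_trans (p0 x))// pq.
rewrite fE; apply: (rho_stepfun_interpolation rY rZ rB C0 c0P interpolation Ew) => //.
- apply: le_trans Yg; apply: (dom _ _ ga) => // k x /EP[] //.
- apply: le_trans Zh; apply: (dom _ _ ha) => // k x /EP[] //.
Qed.

(** The bound from [rho_simple_interpolation] involves the norms of [g] and [h] instead of those of
    the approximants, so it is the same for all [N]. *)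
Lemma sqrt_mul_bounded (g h : R -> R) : mfun0 g -> mfun0 h ->
  (forall x, 0 <= g x) -> (forall x, 0 <= h x) ->
  (rhoY g < +oo)%E -> (rhoZ h < +oo)%E ->
  mfun0 (fun x => Num.sqrt (g x) * Num.sqrt (h x)) /\
  (rhoB (fun x => (Num.sqrt (g x) * Num.sqrt (h x))%R) < +oo)%E.
Proof.
move=> mg mh g0 h0 Yg Zh.
have [c0 c0P] := @profile_lower_bound_ex R.
have Yf : rhoY g \is a fin_num by rewrite ge0_fin_numE// (bfs_ge0 rY.1).
have Zf : rhoZ h \is a fin_num by rewrite ge0_fin_numE// (bfs_ge0 rZ.1).
have mEg : measurable_fun (@Ipos R) (EFin \o g) by exact/measurable_EFinP.
have mEh : measurable_fun (@Ipos R) (EFin \o h) by exact/measurable_EFinP.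
pose ga := nnsfun_approx (@measurable_Ipos R) mEg.
pose ha := nnsfun_approx (@measurable_Ipos R) mEh.
have Ipos0 x : 0 < x -> @Ipos R x by rewrite /Ipos/= in_itv/= andbT.
have approx (f : R -> R) (mf : measurable_fun (@Ipos R) (EFin \o f)) x :
    (forall x, 0 <= f x) -> 0 < x ->
    let fa := nnsfun_approx (@measurable_Ipos R) mf in
    [/\ forall k, fa k x <= fa k.+1 x, forall k, fa k x <= f x
      & fa k x @[k --> \oo] --> f x].
  move=> f0 x0 fa.
  have fnd : {homo (fun k => fa k x) : k l / (k <= l)%N >-> k <= l}.
    by move=> k l kl; have /lefP := nd_nnsfun_approx (@measurable_Ipos R) mf kl; exact.
  have fcv : fa k x @[k --> \oo] --> f x.
    have := cvg_nnsfun_approx (@measurable_Ipos R) mf (fun x _ => f0 x) (Ipos0 _ x0).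
    by move/fine_cvgP => [].
  split => // [k|k]; first exact: fnd.
  rewrite -(cvg_lim _ fcv)//; apply: nondecreasing_cvgn_le => //.
  by apply/cvg_ex; exists (f x).
pose y := fine (rhoY g); pose z := fine (rhoZ h).
have y0 : 0 <= y by rewrite fine_ge0// (bfs_ge0 rY.1).
have z0 : 0 <= z by rewrite fine_ge0// (bfs_ge0 rZ.1).
pose F N x := Num.sqrt (ga N x) * Num.sqrt (ha N x) * \1_(`]0, N%:R]%classic) x.
have FP N : mfun0 (F N) /\
    (rhoB (F N) <= (step_const (n := n) C c0 * Num.sqrt y * Num.sqrt z)%:E)%E.
  apply: (rho_simple_interpolation (g := g) (h := h)) => //.
  - by move=> x x0; have [_ ->] := approx g mEg x g0 x0.
  - by move=> x x0; have [_ ->] := approx h mEh x h0 x0.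
  - by rewrite fineK.
  - by rewrite fineK.
have msqrt (f : R -> R) : mfun0 f -> mfun0 (fun x => Num.sqrt (f x)).
  move=> mf; apply: measurableT_comp => //.
  by apply: continuous_measurable_fun; exact: sqrt_continuous.
have mgh : mfun0 (fun x => Num.sqrt (g x) * Num.sqrt (h x)).
  by apply: measurable_funM; exact: msqrt.
split => //.
have supF : (ereal_sup (range (fun N => rhoB (F N))) < +oo)%E.
  apply: (@le_lt_trans _ _ (step_const (n := n) C c0 * Num.sqrt y * Num.sqrt z)%:E).
    by apply: ge_ereal_sup => _ [N _ <-]; exact: (FP N).2.
  exact: ltry.
rewrite (bfs_fatou rB.1 (fun N => (FP N).1) mgh _ supF)//.
apply: aeW => x; rewrite /Ipos/= in_itv/= andbT => x0.
have [gnd _ gcv] := approx g mEg x g0 x0.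
have [hnd _ hcv] := approx h mEh x h0 x0.
split.
  move=> N; rewrite /F; apply/andP; split; first by rewrite !mulr_ge0 ?sqrtr_ge0.
  apply: ler_pM; rewrite ?mulr_ge0 ?sqrtr_ge0//.
    by apply: ler_pM; rewrite ?sqrtr_ge0// ler_wsqrtr.
  rewrite !indicE ler_nat; have [xN|//] := boolP (x \in `]0, N%:R]%classic).
  rewrite mem_set//=; move: xN; rewrite inE/= !in_itv/= => /andP[-> xN]/=.
  by rewrite (le_trans xN)// ler_nat.
have scv (fa : nat -> R) (l : R) : fa k @[k --> \oo] --> l ->
    Num.sqrt (fa k) @[k --> \oo] --> Num.sqrt l.
  by move=> fl; exact: (cvg_comp _ _ fl (@sqrt_continuous R l)).
rewrite -[X in _ --> X]mulr1; apply: cvgM; first exact: (cvgM (scv _ _ gcv) (scv _ _ hcv)).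
(* The cutoff equals 1 at [x] as soon as [N] exceeds [x]. *)
apply: cvg_near_cst; exists (Num.truncn x).+1 => // N /= xN.
rewrite indicE mem_set//= in_itv/= x0/= (le_trans (ltW (truncnS_gt x)))//.
by rewrite ler_nat.
Qed.

Lemma memCL_memX (f : R -> R) : memCL rhoY rhoZ f -> memX rhoB f.
Proof.
move=> [mf [g [h [[mg Yg] [[mh Zh] [gh0 fgh]]]]]]; split => //.
have mabs (q : R -> R) : mfun0 q -> mfun0 (fun x => `|q x|).
  by move=> mq; apply: measurableT_comp => //; exact: normr_measurable.
have le_abs (rho : (R -> R) -> \bar R) q : RIBFS rho -> mfun0 q ->
    (rho (fun x => `|q x|%R) <= rho q)%E.
  by move=> rhoP mq; apply: rho_le => //; [exact: mabs|move=> x _; rewrite normr_id].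
(* [g] and [h] are nonnegative only almost everywhere. Their absolute values are so everywhere, have
   finite norms by the ideal property, and agree with them almost everywhere. *)
have [mF BF] := @sqrt_mul_bounded (fun x => `|g x|) (fun x => `|h x|)
  (mabs _ mg) (mabs _ mh) (fun x => normr_ge0 _) (fun x => normr_ge0 _)
  (le_lt_trans (le_abs _ _ rY mg) Yg) (le_lt_trans (le_abs _ _ rZ mh) Zh).
apply: le_lt_trans BF; apply: (bfs_ideal rB.1) => //.
apply: (@filterS2 _ _ (ae_filter_ringOfSetsType (@lebesgue_measure R))) gh0 fgh.
move=> x gh0 fgh Ix; apply: le_trans (fgh Ix) _.
have [gx hx] := gh0 Ix; rewrite (ger0_norm gx) (ger0_norm hx).
exact: ler_norm.
Qed.

End interpolation.

Theorem theorem2p2 (R : realType) (d : nat) (hd : (0 < d)%N)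
  (rhoY rhoZ rhoB : (R -> R) -> \bar R) (C : R) :
  RIBFS rhoY -> RIBFS rhoZ -> RIBFS rhoB -> 0 < C ->
  (forall (u : 'rV[R]_d -> R) (Du : 'I_d -> 'rV[R]_d -> R)
          (D2u : 'I_d -> 'I_d -> 'rV[R]_d -> R),
     W21loc u Du D2u -> memd rhoZ u ->
     (nrmd rhoB (gradn Du) <=
        C%:E * poweR (nrmd rhoY (hessn D2u)) 2^-1 * poweR (nrmd rhoZ u) 2^-1)%E) ->
  ((forall f : R -> R, memX rhoZ f /\ Linf f -> memX rhoY f /\ Linf f) ->
     forall f : R -> R, memCL rhoY rhoZ f /\ Linf f -> memX rhoB f /\ Linf f) /\
  ((forall f : R -> R, memX rhoZ f /\ L1 f -> memX rhoY f /\ L1 f) ->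
     forall f : R -> R, memCL rhoY rhoZ f /\ L1 f -> memX rhoB f /\ L1 f).
Proof.
case: d hd => // n _ rY rZ rB C0 interpolation.
have embed f : memCL rhoY rhoZ f -> memX rhoB f.
  exact: (memCL_memX rY rZ rB C0 interpolation).
by split=> _ f [CLf fP]; split => //; exact: embed.
Qed.
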